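(* Let $M$ be a smooth manifold with tangent bundle $\pi:TM\to M$, let $A\subset TM\setminus 0$ be an open subset with $\pi(A)=M$, and let $\delta$ be an anisotropic derivation in $A$ with associated vector field $Z\in\mathfrak{X}(M)$. Then there exists a unique tensor derivation $\mathcal{D}$ (acting on $A$-anisotropic tensors) such that (a) $\mathcal{D}(X)(v)=\delta^vX$ for every $X\in\mathfrak{X}(M)$ and $v\in A$, and (b) for every $h\in\mathcal{F}(A)$ and $v\in A$, $$\mathcal{D}(h)(v)=Z(h(V))(\pi(v))-(\partial^\nu h)_v(\delta^vV),$$ where $V$ is any $A$-admissible vector field on an open subset $\Omega\subset M$ containing $\pi(v)$ such that $V(\pi(v))=v$ (the right-hand side does not depend on the choice of $V$).
   Context: $\mathfrak{X}(M)$ denotes smooth vector fields on $M$, $\mathcal{F}(M)$ and $\mathcal{F}(A)$ smooth real functions on $M$ and on $A$. Anisotropic tensors: $\mathfrak{T}^r_s(M,A)$ is the space of $A$-anisotropic $(r,s)$-tensors, i.e. smooth maps $T$ assigning to each $v\in A$ an element $T_v\in (T_{\pi(v)}M)^{\otimes r}\otimes (T_{\pi(v)}^*M)^{\otimes s}$ (smooth sections over $A$ of the corresponding tensor bundle pulled back by $\pi|_A$). By definition $\mathfrak{T}^0_0(M,A)=\mathcal{F}(A)$. A vector field $X\in\mathfrak{X}(M)$ is regarded as an element of $\mathfrak{T}^1_0(M,A)$ via $v\mapsto X(\pi(v))$. Tensor products and contractions are defined pointwise in $v\in A$. A vector field $V$ on an open set $\Omega\subset M$ is $A$-admissible if $V(p)\in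 A$ for all $p\in\Omega$; then $h(V)$ denotes the function $p\mapsto h(V(p))$ on $\Omega$. For $h\in\mathcal{F}(A)$, $v\in A$ and $w\in T_{\pi(v)}M$, $(\partial^\nu h)_v(w)=\frac{d}{dt}h(v+tw)|_{t=0}$. Anisotropic derivation in $A$ with associated vector field $Z\in\mathfrak{X}(M)$: a map $\delta:A\times\mathfrak{X}(M)\to TM$, $(v,X)\mapsto\delta^vX\in T_{\pi(v)}M$, such that $v\mapsto\delta^vX$ belongs to $\mathfrak{T}^1_0(M,A)$ (in particular is smooth) for every $X$, $\delta^v(X+Y)=\delta^vX+\delta^vY$, and $\delta^v(fX)=Z(f)(\pi(v))X(\pi(v))+f(\pi(v))\delta^vX$ for all $f\in\mathcal{F}(M)$, $X,Y\in\mathfrak{X}(M)$. Such a map is local, so $\delta^vV$ makes sense for $V$ defined only near $\pi(v)$. Tensor derivation: a family of $\mathbb{R}$-linear maps $\mathcal{D}:\mathfrak{T}^r_s(M,A)\to\mathfrak{T}^r_s(M,A)$, for all $r,s\ge 0$, such that (i) $\mathcal{D}(T_1\otimes T_2)=\mathcal{D}T_1\otimes T_2+T_1\otimes\mathcal{D}T_2$ for all anisotropic tensors $T_1,T_2$, and (ii) $\mathcal{D}(\mathbf{C}(T))=\mathbf{C}(\mathcal{D}(T))$ for every contraction $\mathbf{C}$ and every anisotropic tensor $T$. *)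

(* Defs.v *)
From HB Require Import structures.
From mathcomp Require Import all_boot all_order all_algebra.
From mathcomp Require Import all_classical all_reals all_analysis.
Import Order.TTheory GRing.Theory Num.Theory numFieldNormedType.Exports.

Set Implicit Arguments.
Unset Strict Implicit.
Unset Printing Implicit Defensive.

Local Open Scope classical_set_scope.
Local Open Scope ring_scope.

(* [Ck k U f]: on U, all iterated directional derivatives of f of order at
   most k exist and are continuous.  Only used for U open in a
   finite-dimensional V, where this is the usual notion of class C^k. *)
Fixpoint Ck (R : realType) (V W : normedModType R) (k : nat) (U : set V)
    (f : V -> W) : Prop :=
  (forall x, U x -> {for x, continuous f}) /\
  (if k is k'.+1 then
     forall u : V, (forall x, U x -> derivable f x u) /\
                   Ck k' U (fun x => 'D_u f x)
   else True).

Definition smooth_on (R : realType) (V W : normedModType R) (U : set V)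
  (f : V -> W) : Prop := forall k, Ck k U f.

(* The two maps are total, but only [chart_map] on [chart_dom] and
   [chart_inv] on the image of [chart_dom] are meaningful. *)
Record chart (R : realType) (n : nat) (M : topologicalType) := Chart {
  chart_dom : set M;
  chart_map : M -> 'rV[R]_n;
  chart_inv : 'rV[R]_n -> M;
  chart_dom_open : open chart_dom;
  chart_cod_open : open (chart_map @` chart_dom);
  chart_mapK : forall p, chart_dom p -> chart_inv (chart_map p) = p;
  chart_map_continuous : {within chart_dom, continuous chart_map};
  chart_inv_continuous :
    {within chart_map @` chart_dom, continuous chart_inv} }.

Definition chart_cod (R : realType) (n : nat) (M : topologicalType)
  (c : chart R n M) : set 'rV[R]_n := chart_map c @` chart_dom c.

(* Smooth n-manifold without boundary.  [chart_at] is a choice, for every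
   point, of a chart of the atlas around it; it carries no smoothness and is
   only used to represent tangent vectors. *)
Record manifold (R : realType) (n : nat) := Manifold {
  space :> topologicalType;
  space_hausdorff : hausdorff_space space;
  space_second_countable : @second_countable space;
  atlas : set (chart R n space);
  chart_at : space -> chart R n space;
  chart_at_atlas : forall p, atlas (chart_at p);
  chart_at_dom : forall p, chart_dom (chart_at p) p;
  atlas_smooth : forall c d, atlas c -> atlas d ->
    smooth_on [set x | chart_cod c x /\ chart_dom d (chart_inv c x)]
              (fun x => chart_map d (chart_inv c x)) }.

Section Manifolds.
Variables (R : realType) (n : nat) (M : manifold R n).
Implicit Types (c d : chart R n M) (p : M) (w : 'rV[R]_n).

(* T_pM is represented by 'rV[R]_n: w stands for the tangent vector at p whose
   components in the preferred chart [chart_at p] are w.  The components in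
   any other chart are obtained with [chart_change], so p |-> w is not a
   trivialization of TM: smoothness is always tested in charts of the atlas. *)
Record tangent := Tangent { base : M; vec : 'rV[R]_n }.

(* d(d o c^-1) at c(p), applied to w *)
Definition chart_change c d p w : 'rV[R]_n :=
  'D_w (fun x => chart_map d (chart_inv c x)) (chart_map c p).

(* components in the chart c of the tangent vector w at p *)
Definition to_chart c p w : 'rV[R]_n := chart_change (chart_at p) c p w.

(* tangent vector at p with components y in the chart c *)
Definition of_chart c p (y : 'rV[R]_n) : 'rV[R]_n :=
  chart_change c (chart_at p) p y.

(* inverse of the chart of TM induced by c *)
Definition tangent_lift c (z : 'rV[R]_n * 'rV[R]_n) : tangent :=
  Tangent (chart_inv c z.1) (of_chart c (chart_inv c z.1) z.2).

Definition tangent_chart_set c (A : set tangent) : set ('rV[R]_n * 'rV[R]_n) :=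
  [set z | chart_cod c z.1 /\ A (tangent_lift c z)].

(* open sets of TM, for the topology whose charts are the inverses of the
   [tangent_lift c] *)
Definition tangent_open (A : set tangent) : Prop :=
  forall c, atlas c -> open (tangent_chart_set c A).

Definition chart_set c (O : set M) : set 'rV[R]_n :=
  [set x | chart_cod c x /\ O (chart_inv c x)].

Definition smooth_fun (O : set M) (f : M -> R) : Prop :=
  forall c, atlas c -> smooth_on (chart_set c O) (f \o chart_inv c).

Definition smooth_vfield (O : set M) (X : M -> 'rV[R]_n) : Prop :=
  forall c, atlas c ->
    smooth_on (chart_set c O)
              (fun x => to_chart c (chart_inv c x) (X (chart_inv c x))).

(* w(f), for w a tangent vector at p *)
Definition tangent_deriv (f : M -> R) p w : R :=
  'D_w (f \o chart_inv (chart_at p)) (chart_map (chart_at p) p).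

(* Covectors at p are column vectors, dual to the representation of T_pM. *)
Definition pairing (a : 'cV[R]_n) (w : 'rV[R]_n) : R := (w *m a) ord0 ord0.

(* Coordinate frame d/dx^j and coframe dx^i of the chart c at the point p *)
Definition coord_vec c p (j : 'I_n) : 'rV[R]_n :=
  of_chart c p (delta_mx ord0 j).

Definition coord_covec c p (i : 'I_n) : 'cV[R]_n :=
  \col_j to_chart c p (delta_mx ord0 j) ord0 i.

Section Anisotropic.
Variable A : set tangent.

Definition foot (v : A) : M := base (val v).

(* An element of (T_pM)^{(x) r} (x) (T_p^*M)^{(x) s} is a function of r
   covectors and s vectors at p, linear in each of them. *)
Definition tensor (r s : nat) : Type :=
  A -> ('I_r -> 'cV[R]_n) -> ('I_s -> 'rV[R]_n) -> R.

Definition multilinear r s (T : tensor r s) : Prop :=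
  (forall (v : A) (th : 'I_r -> 'cV[R]_n) (X : 'I_s -> 'rV[R]_n)
     (k : 'I_r) (t : R) (a b : 'cV[R]_n),
     T v [eta th with k |-> t *: a + b] X =
     t * T v [eta th with k |-> a] X + T v [eta th with k |-> b] X) /\
  (forall (v : A) (th : 'I_r -> 'cV[R]_n) (X : 'I_s -> 'rV[R]_n)
     (l : 'I_s) (t : R) (x y : 'rV[R]_n),
     T v th [eta X with l |-> t *: x + y] =
     t * T v th [eta X with l |-> x] + T v th [eta X with l |-> y]).

(* extension by 0 outside A *)
Definition ext0 (h : A -> R) : tangent -> R :=
  fun u => oapp h 0 (insub u : option A).

Definition smooth_afun_in c (h : A -> R) : Prop :=
  smooth_on (tangent_chart_set c A) (ext0 h \o tangent_lift c).

Definition smooth_afun (h : A -> R) : Prop :=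
  forall c, atlas c -> smooth_afun_in c h.

(* T belongs to the space of A-anisotropic (r,s)-tensors: in every chart its
   components are smooth functions on A. *)
Definition atensor r s (T : tensor r s) : Prop :=
  multilinear T /\
  forall c, atlas c -> forall (I : 'I_r -> 'I_n) (J : 'I_s -> 'I_n),
    smooth_afun_in c (fun v : A =>
      T v (fun k => coord_covec c (foot v) (I k))
          (fun l => coord_vec c (foot v) (J l))).

Definition scalar_tensor (h : A -> R) : tensor 0 0 := fun v _ _ => h v.

Definition vector_tensor (F : A -> 'rV[R]_n) : tensor 1 0 :=
  fun v th _ => pairing (th ord0) (F v).

Definition vfield_tensor (X : M -> 'rV[R]_n) : tensor 1 0 :=
  vector_tensor (fun v => X (foot v)).

Definition add_tensor r s (T1 T2 : tensor r s) : tensor r s :=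
  fun v th X => T1 v th X + T2 v th X.

Definition scale_tensor r s (t : R) (T : tensor r s) : tensor r s :=
  fun v th X => t * T v th X.

Definition prod_tensor r1 s1 r2 s2 (T1 : tensor r1 s1) (T2 : tensor r2 s2) :
    tensor (r1 + r2) (s1 + s2) :=
  fun v th X => T1 v (th \o lshift r2) (X \o lshift s2) *
                T2 v (th \o @rshift r1 r2) (X \o @rshift s1 s2).

Definition insert_at (E : Type) m (k : 'I_m.+1) (x : E) (f : 'I_m -> E) :
    'I_m.+1 -> E :=
  fun i => oapp f x (unlift k i).

(* contraction of the k-th contravariant slot with the l-th covariant one *)
Definition contraction r s (k : 'I_r.+1) (l : 'I_s.+1)
    (T : tensor r.+1 s.+1) : tensor r s :=
  fun v th X => \sum_(a < n) T v (insert_at k (delta_mx a ord0) th)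
                                 (insert_at l (delta_mx ord0 a) X).

(* Only the values of D on [atensor] matter. *)
Record tensor_derivation (D : forall r s, tensor r s -> tensor r s) : Prop := {
  tder_closed : forall r s (T : tensor r s), atensor T -> atensor (D r s T);
  tder_linear : forall r s (t : R) (T1 T2 : tensor r s),
    atensor T1 -> atensor T2 ->
    D r s (add_tensor (scale_tensor t T1) T2) =
    add_tensor (scale_tensor t (D r s T1)) (D r s T2);
  tder_prod : forall r1 s1 r2 s2 (T1 : tensor r1 s1) (T2 : tensor r2 s2),
    atensor T1 -> atensor T2 ->
    D _ _ (prod_tensor T1 T2) =
    add_tensor (prod_tensor (D _ _ T1) T2) (prod_tensor T1 (D _ _ T2));
  tder_contraction : forall r s (k : 'I_r.+1) (l : 'I_s.+1)
      (T : tensor r.+1 s.+1),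
    atensor T -> D r s (contraction k l T) = contraction k l (D _ _ T) }.

(* delta^v X is only meaningful for X a smooth vector field on M. *)
Record anisotropic_derivation (delta : A -> (M -> 'rV[R]_n) -> 'rV[R]_n)
    (Z : M -> 'rV[R]_n) : Prop := {
  ader_vfield : smooth_vfield setT Z;
  ader_smooth : forall X, smooth_vfield setT X ->
    atensor (vector_tensor (fun v => delta v X));
  ader_add : forall X Y (v : A), smooth_vfield setT X -> smooth_vfield setT Y ->
    delta v (fun p => X p + Y p) = delta v X + delta v Y;
  ader_leibniz : forall f X (v : A),
    smooth_fun setT f -> smooth_vfield setT X ->
    delta v (fun p => f p *: X p) =
      tangent_deriv f (foot v) (Z (foot v)) *: X (foot v)
      + f (foot v) *: delta v X }.

Definition admissible (O : set M) (V : M -> 'rV[R]_n) : Prop :=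
  smooth_vfield O V /\ forall p, O p -> A (Tangent p (V p)).

(* h(V); its value is 0 at the points where V does not belong to A *)
Definition afun_comp (h : A -> R) (V : M -> 'rV[R]_n) : M -> R :=
  fun p => ext0 h (Tangent p (V p)).

Definition vertical_deriv (h : A -> R) (v : A) (w : 'rV[R]_n) : R :=
  derive1 (fun t : R => ext0 h (Tangent (foot v) (vec (val v) + t *: w))) 0.

(* [delta_local delta v V w]: w is delta^v V, for V a vector field defined
   only near the base point of v.  It is delta^v of any global vector field
   with the same germ there (one exists by means of a bump function). *)
Definition delta_local (delta : A -> (M -> 'rV[R]_n) -> 'rV[R]_n) (v : A)
    (V : M -> 'rV[R]_n) (w : 'rV[R]_n) : Prop :=
  exists W : M -> 'rV[R]_n, [/\ smooth_vfield setT W,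
    \forall p \near foot v, W p = V p & w = delta v W].

Definition extends_derivation
    (delta : A -> (M -> 'rV[R]_n) -> 'rV[R]_n) (Z : M -> 'rV[R]_n)
    (D : forall r s, tensor r s -> tensor r s) : Prop :=
  (forall X : M -> 'rV[R]_n, smooth_vfield setT X ->
     D 1 0 (vfield_tensor X) = vector_tensor (fun v => delta v X)) /\
  (forall h : A -> R, smooth_afun h ->
   forall (v : A) (O : set M) (V : M -> 'rV[R]_n) (w : 'rV[R]_n),
     open O -> O (foot v) -> admissible O V ->
     V (foot v) = vec (val v) -> delta_local delta v V w ->
     forall th X,
       D 0 0 (scalar_tensor h) v th X =
       tangent_deriv (afun_comp h V) (foot v) (Z (foot v))
       - vertical_deriv h v w).

End Anisotropic.
End Manifolds.

(* Main.v *)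
(* Existence. In a chart c, delta is encoded by the matrices Gamma(v) whose rows
   are the components of delta^v (d/dx^i).  Along the curve
   (x + t Z, y (1 - t Gamma)) through v, let vectors move as X (1 - t Gamma) and
   covectors as (1 + t Gamma) th, and define (D T)_v (th, X) as the derivative
   at t = 0 of T evaluated on these moving arguments.  By multilinearity this
   derivative only depends on the first-order data of the curves, and the
   transformation law of Gamma shows that these data correspond to each other in
   any two charts.  So D T does not depend on the chart; it is smooth because
   its components are polynomials in smooth functions.  The Leibniz rule is the
   product rule, and D commutes with contractions because
   (1 + t Gamma) (1 - t Gamma) = 1 + o(t).

   Uniqueness. On functions D is prescribed by (b).  Every vector (covector) at
   a point is the value of a global vector field W (of a differential dg), and
   inserting it in a slot of T is the contraction of W (x) T (of dg (x) T), so
   the values of D on tensors with one more slot follow from the Leibniz rule. *)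
Require Import Defs.
From HB Require Import structures.
From mathcomp Require Import all_boot all_order all_algebra.
From mathcomp Require Import all_classical all_reals all_analysis.
From mathcomp Require Import ring lra.
Import Order.TTheory GRing.Theory Num.Theory numFieldNormedType.Exports.
Set Implicit Arguments.
Unset Strict Implicit.
Unset Printing Implicit Defensive.
Local Open Scope classical_set_scope.
Local Open Scope ring_scope.

(** * Directional derivatives *)

(** Smoothness is defined by iterated directional derivatives, while changing charts and
    differentiating along curves need the chain rule, hence Fréchet differentiability;
    [C1_differentiable] recovers it. The derivation has two faces. It is an explicit polynomial,
    [jet], which gives smoothness, and it is the derivative at 0 of [local_rep] along a curve, which
    gives the algebraic rules. Affine curves replace the flow of Z because a jet sees only
    velocities. The fibre velocity - y Gamma(v) is forced by (b): in a chart delta^v V = Z(V) + y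
    Gamma(v), so Z(h(V)) minus the vertical derivative along delta^v V is the derivative of h in the
    direction (Z, - y Gamma(v)), from which V has cancelled. The preferred charts may jump from
    point to point, so smoothness is always tested after moving to a fixed chart. For uniqueness,
    (a) and (b) do not prescribe the value on dg. Covariant slots are therefore treated first, with
    vector fields alone; this settles type (0,1), in particular dg, and only then do contravariant
    slots become accessible. *)

Lemma is_derive_scalel (R : realType) (V : normedModType R) (t : R) (u : V) :
  is_derive t (1 : R) (fun s : R => s *: u) u.
Proof.
have [d dE] := is_diff_scalel t u.
split; first exact/derivable1_diffP.
by rewrite deriveE// dE scale1r.
Qed.

Lemma cvg_sumr (R : realType) (V : normedModType R) (T I : Type)
    (F : set_system T) (r : seq I) (P : pred I) (f : I -> T -> V) (l : I -> V) :
  Filter F -> (forall i, P i -> f i x @[x --> F] --> l i) ->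
  \sum_(i <- r | P i) f i x @[x --> F] --> \sum_(i <- r | P i) l i.
Proof. by move=> FF fl; apply: cvg_big => //; exact: add_continuous. Qed.

Lemma derive_line (R : realType) (V W : normedModType R) (f : V -> W) x v :
  'D_v f x = 'D_1 (fun h : R => f (h *: v + x)) 0.
Proof.
rewrite /derive; set F := (fun _ => _); set G := (fun _ => _).
suff -> : F = G by [].
by apply/funext => h; rewrite /F /G /= scale0r add0r addr0 scaler1.
Qed.

Lemma is_derive_curve (R : realType) (V W : normedModType R) (f : V -> W)
    (z : R -> V) (t : R) (dz : V) :
  is_derive t (1 : R) z dz -> differentiable f (z t) ->
  is_derive t (1 : R) (f \o z) ('D_dz f (z t)).
Proof.
move=> [dzt zE] df; have dz' : differentiable z t by exact/derivable1_diffP.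
split; first exact/derivable1_diffP/differentiable_comp.
rewrite deriveE; last exact: differentiable_comp.
by rewrite diff_comp // [LHS]/= -(deriveE _ dz') zE deriveE.
Qed.

Lemma deriveDir (R : realType) (V W : normedModType R) (f : V -> W) x
    (a : R) (u v : V) : differentiable f x ->
  'D_(a *: u + v) f x = a *: 'D_u f x + 'D_v f x.
Proof.
by move=> df; rewrite !deriveE// linearPZ.
Qed.

Lemma deriveDirZ (R : realType) (V W : normedModType R) (f : V -> W) x
    (a : R) (u : V) : differentiable f x ->
  'D_(a *: u) f x = a *: 'D_u f x.
Proof.
by move=> df; have := deriveDir a u 0 df; rewrite derive0 !addr0.
Qed.

Lemma derive_dir1 (R : realType) (W : normedModType R) (f : R -> W) (a x : R) :
  differentiable f x -> 'D_a f x = a *: 'D_1 f x.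
Proof. by move=> df; have := deriveDirZ a (1 : R) df; rewrite [a *: 1]mulr1. Qed.

(** * Functions with continuous partial derivatives are differentiable *)

Section Basis.
Variable R : realType.

(** This stands in for finite dimension. It covers the real line, row vectors and the product of
    base and fibre in the same way, so the calculus below is done once for all of them. *)
Definition coordinates (V : normedModType R) N (e : 'I_N -> V)
    (co : 'I_N -> V -> R) : Prop :=
  [/\ forall i (t : R) x y, co i (t *: x + y) = t * co i x + co i y,
      forall i, continuous (co i) &
      forall x, x = \sum_i co i x *: e i].

Section C1.
Variables (V : normedModType R) (N : nat) (e : 'I_N -> V)
  (co : 'I_N -> V -> R) (eco : coordinates e co).

Lemma coord0 i : co i 0 = 0.
Proof.
have [l _ _] := eco; have := l i 1 0 0.
rewrite scale1r addr0 mul1r => h; apply: (@addrI _ (co i 0)).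
by rewrite -h addr0.
Qed.

Lemma coordD i x y : co i (x + y) = co i x + co i y.
Proof. by have [l _ _] := eco; rewrite -[x]scale1r l scale1r mul1r. Qed.

Lemma coordZ i t x : co i (t *: x) = t * co i x.
Proof.
by have [l _ _] := eco; have := l i t x 0; rewrite !addr0 coord0 addr0.
Qed.

(** Continuity at 0 makes the form smaller than 1 on a ball of some radius d; rescaling x to norm d
    / 2 and using homogeneity gives the constant 2 / d. *)
Lemma coord_bound i : exists2 k : R, 0 < k & forall x, `|co i x| <= k * `|x|.
Proof.
have [_ cc _] := eco.
have /cvgrPdist_lt /(_ 1 ltr01) := cc i 0.
rewrite coord0 => /nbhs_ballP[d /= d0 hd].
exists (2 / d); first by rewrite divr_gt0.
move=> x; have [->|x0] := eqVneq x 0; first by rewrite coord0 !normr0 mulr0.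
have xp : 0 < `|x| by rewrite normr_gt0.
have nd : `|(d / 2 / `|x|) *: x| = d / 2.
  rewrite normrZ ger0_norm ?divfK ?gt_eqF// divr_ge0// ltW//.
  by rewrite divr_gt0.
have : `|0 - co i ((d / 2 / `|x|) *: x)| < 1.
  apply: hd; rewrite -ball_normE /= sub0r normrN nd.
  by rewrite ltr_pdivrMr// ltr_pMr// ltr1n.
rewrite sub0r normrN coordZ normrM ger0_norm; last first.
  by rewrite divr_ge0// ltW// divr_gt0.
rewrite -ltr_pdivlMl ?divr_gt0// mulr1 => /ltW/le_trans; apply.
by rewrite !invf_div mulrC; have := d0; rewrite mulrC mulrA lexx.
Qed.

(** The mean value theorem on the segment from y to y + a u. The segment is parametrized by [0, 1]
    so that the sign of a does not matter; the factor |a| is the speed of this parametrization. *)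
Lemma slope_estimate (f : V -> R) (u : V) (y : V) (a m eps : R) :
  (forall t, 0 <= t <= 1 -> derivable f (y + (t * a) *: u) u) ->
  (forall t, 0 <= t <= 1 -> `|'D_u f (y + (t * a) *: u) - m| <= eps) ->
  `|f (y + a *: u) - f y - a * m| <= eps * `|a|.
Proof.
move=> df Df.
pose g t : R := f (y + (t * a) *: u).
have dg (t : R) : 0 <= t <= 1 ->
    is_derive t (1 : R) g (a * 'D_u f (y + (t * a) *: u)).
  move=> ht; have /derivable1P := df _ ht; set k := (fun h => _) => dk.
  have gk : g = k \o (fun s => (s - t) * a).
    apply/funext => s; rewrite /g /k /=; congr f.
    by rewrite addrCA -scalerDl -mulrDl subrK.
  have dk0 : is_derive (0 : R) (1 : R) k ('D_u f (y + (t * a) *: u)).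
    by split => //; rewrite [RHS]derive_line.
  pose l (s : R) : R := (s - t) * a.
  have l0 : l t = 0 by rewrite /l subrr mul0r.
  have dl : is_derive t (1:R) l a.
    have -> : l = (fun s => s *: a) + cst (- (t * a)).
      by apply/funext => s; rewrite /l mulrBl.
    by have := is_deriveD (is_derive_scalel t a) (is_derive_cst (- (t * a)) t 1);
      rewrite addr0.
  have dkl : differentiable k (l t) by rewrite l0; apply/derivable1_diffP.
  rewrite gk; have := is_derive_curve dl dkl.
  by rewrite (derive_dir1 _ dkl) l0 (@derive_val _ _ _ _ _ _ _ dk0).
have cg : {within `[0, 1], continuous g}.
  apply: derivable_within_continuous => t; rewrite in_itv /= => ht.
  by case: (dg _ ht).
have [|c] :=
  @MVT_segment _ g (fun t => a * 'D_u f (y + (t * a) *: u)) 0 1 ler01 _ cg.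
  move=> t; rewrite in_itv /= => /andP[t0 t1]; apply: dg.
  by rewrite (ltW t0) (ltW t1).
rewrite in_itv /= => hc; rewrite /g mul0r scale0r addr0 mul1r subr0 mulr1 => ->.
by rewrite -mulrBr normrM mulrC ler_wpM2r// Df.
Qed.

Lemma sum_ord_ltS (G : zmodType) (F : 'I_N -> G) j (jN : (j < N)%N) :
  \sum_(i < N | (i < j.+1)%N) F i =
  \sum_(i < N | (i < j)%N) F i + F (Ordinal jN).
Proof.
rewrite (bigD1 (Ordinal jN)) //= addrC; congr (_ + _); apply: eq_bigl => i.
by rewrite -val_eqE /= ltnS ltn_neqAle andbC.
Qed.

(** Go from x to x + h along a broken path that changes one coordinate at a time. On each leg
    [slope_estimate] compares f with its partial derivative at x, and the errors add up to at most
    eps |h|. *)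
Lemma C1_differentiable (U : set V) (f : V -> R) (x : V) :
  open U -> Ck 1 U f -> U x -> differentiable f x.
Proof.
move=> oU [fc fd] Ux; have [_ _ xE] := eco.
pose m i := 'D_(e i) f x.
pose L h := \sum_i co i h * m i.
have Llin : linear L.
  move=> t y z; rewrite /L scaler_sumr -big_split /=; apply: eq_bigr => i _.
  by rewrite coordD coordZ mulrDl -mulrA.
pose Lm := GRing.isLinear.Build _ _ _ _ _ Llin.
pose LL : {linear V -> R} := HB.pack L Lm.
have Lc : continuous LL.
  move=> y; rewrite /LL /= /L; apply: cvg_sumr => i _.
  by apply: cvgM; [case: eco => _ + _; apply|exact: cvg_cst].
suff h : f \o shift x = cst (f x) + LL +o_ (0 : V) id.
  by apply/diff_locallyP; rewrite (diff_unique Lc h).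
apply/eqaddoP => _/posnumP[eps].
pose k i : R := sval (cid2 (coord_bound i)).
have k0 i : 0 < k i by rewrite /k; case: cid2.
have kP i y : `|co i y| <= k i * `|y| by rewrite /k; case: cid2.
(* K |h| bounds the sum of the coordinates of h in absolute value, and C |h| bounds the length of
   the broken path. The later denominators K + 1 and C + 1 avoid a division by 0. *)
pose K := \sum_i k i; pose C := \sum_i k i * `|e i|.
have K0 : 0 <= K by apply: sumr_ge0 => i _; exact/ltW.
have C0 : 0 <= C by apply: sumr_ge0 => i _; rewrite mulr_ge0// ltW.
pose eps' := eps%:num / (K + 1).
have eps'0 : 0 < eps' by rewrite divr_gt0// ltr_wpDl.
have : \forall y \near x, U y /\ forall i, `|'D_(e i) f y - m i| <= eps'.
  apply: filterI; first exact: open_nbhs_nbhs.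
  apply: filter_forall => i.
  have [_ [Dc _]] := fd (e i).
  have /cvgrPdist_le /(_ _ eps'0) := Dc x Ux.
  by apply: filterS => y; rewrite distrC.
move=> /nbhs_ballP[d /= d0 hd].
near=> h.
(* The vertices of the broken path are the points x + S j. *)
pose S j := \sum_(i < N | (i < j)%N) co i h *: e i.
have Ch : C * `|h| < d.
  rewrite (@le_lt_trans _ _ ((C + 1) * `|h|)) ?ler_wpM2r ?lerDl//.
  rewrite -ltr_pdivlMl ?ltr_wpDl//; near: h.
  by apply: dnbhs0_lt || apply: nbhs0_lt; rewrite mulr_gt0// invr_gt0 ltr_wpDl.
have inball j (jN : (j < N)%N) t : 0 <= t <= 1 ->
    ball x d (x + S j + (t * co (Ordinal jN) h) *: e (Ordinal jN)).
  move=> /andP[t0 t1]; rewrite -ball_normE /=.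
  rewrite -addrA opprD addrA subrr sub0r normrN; apply: le_lt_trans Ch.
  rewrite mulr_suml (le_trans (ler_normD _ _))//.
  rewrite (bigID (fun i : 'I_N => (i < j.+1)%N)) /= sum_ord_ltS -addrA lerD//.
    apply: le_trans (ler_norm_sum _ _ _) _; apply: ler_sum => i _.
    by rewrite normrZ mulrAC ler_wpM2r.
  rewrite ler_wpDr ?sumr_ge0//.
    by move=> i _; rewrite !mulr_ge0// ltW.
  rewrite normrZ mulrAC ler_wpM2r// normrM (ger0_norm t0).
  by apply: le_trans (kP _ h); rewrite ler_piMl.
have main j : (j <= N)%N ->
  `|f (x + S j) - f x - \sum_(i < N | (i < j)%N) co i h * m i|
  <= eps' * \sum_(i < N | (i < j)%N) `|co i h|.
  elim: j => [|j ih] jN.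
    by rewrite /S !big_pred0// addr0 subr0 subrr normr0 mulr0.
  rewrite /S !sum_ord_ltS -/(S j) mulrDr; set a := co _ h.
  have tri (p q r s t : R) : p - q - (r + s) = (t - q - r) + (p - t - s) by ring.
  rewrite (tri _ _ _ _ (f (x + S j))) (le_trans (ler_normD _ _))//.
  rewrite lerD ?ih 1?ltnW//.
  rewrite addrA; apply: slope_estimate => t ht; last first.
    by apply: (hd _ (inball _ _ _ ht)).2.
  by have [+ _] := fd (e (Ordinal jN)); apply; exact: (hd _ (inball _ _ _ ht)).1.
have := main N (leqnn N).
have aN (G : zmodType) (F : 'I_N -> G) :
  \sum_(i < N | (i < N)%N) F i = \sum_i F i.
  by apply: eq_bigl => i; rewrite ltn_ord.
rewrite /S !aN -xE /= [x + h]addrC => /le_trans; rewrite opprD addrA; apply.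
apply: (@le_trans _ _ (eps' * (K * `|h|))).
  apply: ler_wpM2l; first exact: ltW.
  by rewrite mulr_suml; apply: ler_sum => i _; exact: kP.
rewrite mulrA ler_wpM2r// /eps' mulrAC ler_pdivrMr ?ltr_wpDl//.
by rewrite ler_wpM2l// lerDl.
Unshelve. all: by end_near. Qed.

End C1.
End Basis.

(** * Functions of class C^k *)

Section CkTheory.
Variable R : realType.
Implicit Types (V W : normedModType R).

Lemma is_derive_lineP V W (f : V -> W) x u d :
  is_derive x u f d <-> is_derive (0 : R) (1 : R) (fun h : R => f (h *: u + x)) d.
Proof.
split=> -[h1 h2]; split.
- by move/derivable1P : h1.
- by rewrite -derive_line.
- exact/derivable1P.
- by rewrite derive_line.
Qed.

Lemma is_derive_chain V W (Y : normedModType R) (f : V -> W) (g : W -> Y) x u d :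
  is_derive x u f d -> differentiable g (f x) ->
  is_derive x u (g \o f) ('D_d g (f x)).
Proof.
move=> /is_derive_lineP df dg; apply/is_derive_lineP.
have := is_derive_curve df; rewrite scale0r add0r; exact.
Qed.

Lemma is_derive_scale V W (f : V -> R) x u d (w : W) :
  is_derive x u f d -> is_derive x u (fun y => f y *: w) (d *: w).
Proof.
move=> df; have [sd sE] := is_diff_scalel (f x) w.
by have := is_derive_chain df sd; rewrite deriveE// sE.
Qed.

(** On an open set, equality of functions is equality of germs, which passes to limits and
    directional derivatives. *)
Lemma Ck_ext V W k (U : set V) (f g : V -> W) : open U ->
  (forall x, U x -> f x = g x) -> Ck k U f -> Ck k U g.
Proof.
move=> oU.
have near_fg (f' g' : V -> W) : (forall x, U x -> f' x = g' x) ->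
    forall x, U x -> \forall y \near x, f' y = g' y.
  by move=> fg x Ux; apply: filterS (open_nbhs_nbhs (conj oU Ux)) => y; exact: fg.
elim: k f g => [|k ih] f g fg [fc fd].
  split=> // x Ux; have : f x = g x by exact: fg.
  rewrite /prop_for /continuous_at => <-.
  by apply: cvg_trans (fc x Ux); apply: near_eq_cvg; exact: near_fg.
split.
  move=> x Ux; have : f x = g x by exact: fg.
  rewrite /prop_for /continuous_at => <-.
  by apply: cvg_trans (fc x Ux); apply: near_eq_cvg; exact: near_fg.
move=> u; have [du Du] := fd u; split.
  move=> x Ux; have d := du x Ux.
  by have := near_eq_derivable (near_fg _ _ fg _ Ux) d; exact.
by apply: ih Du => x Ux; apply: near_eq_derive; exact: near_fg.
Qed.

(** Each clause of [Ck] is a condition at single points of U, with limits taken in the whole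
    space. *)
Lemma Ck_local V W k (U : set V) (f : V -> W) :
  (forall x, U x -> exists2 U' : set V, U' x & Ck k U' f) -> Ck k U f.
Proof.
elim: k f => [|k ih] f loc.
  by split=> // x /loc[U' U'x [fc _]]; exact: fc.
split; first by move=> x /loc[U' U'x [fc _]]; exact: fc.
move=> u; split.
  by move=> x /loc[U' U'x [_ fd]]; have [+ _] := fd u; apply.
apply: ih => x /loc[U' U'x [_ fd]]; exists U' => //.
by have [_ +] := fd u.
Qed.

Lemma Ck_mono V W k (U U' : set V) (f : V -> W) :
  U `<=` U' -> Ck k U' f -> Ck k U f.
Proof. by move=> UU' fU'; apply: Ck_local => x /UU'; exists U'. Qed.

Lemma CkS V W k (U : set V) (f : V -> W) : Ck k.+1 U f -> Ck k U f.
Proof.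
elim: k f => [|k ih] f [fc fd]; first by split.
by split=> // u; have [du Du] := fd u; split=> //; exact: ih.
Qed.

Lemma Ck_le V W j k (U : set V) (f : V -> W) :
  (j <= k)%N -> Ck k U f -> Ck j U f.
Proof.
move=> /subnK <-; elim: (k - j)%N f => [//|m ih] f fk.
by apply/ih/CkS.
Qed.

Lemma Ck_cst V W k (U : set V) (w : W) : Ck k U (cst w).
Proof.
elim: k w => [|k ih] w; first by split=> // x Ux; exact: cvg_cst.
split; first by move=> x Ux; exact: cvg_cst.
move=> u; split; first by move=> x _; exact: derivable_cst.
have -> : (fun x => 'D_u (cst w) x) = cst (0 : W) :> (V -> W).
  by apply/funext => x; rewrite derive_cst.
exact: ih.
Qed.

Lemma Ck_continuous V W k (U : set V) (f : V -> W) x :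
  Ck k U f -> U x -> {for x, continuous f}.
Proof. by case: k => [|k] [fc _] Ux; exact: fc. Qed.

Lemma CkD V W k (U : set V) (f g : V -> W) : open U ->
  Ck k U f -> Ck k U g -> Ck k U (fun x => f x + g x).
Proof.
move=> oU; elim: k f g => [|k ih] f g [fc fd] [gc gd].
  by split=> // x Ux; apply: cvgD; [exact: fc|exact: gc].
split; first by move=> x Ux; apply: cvgD; [exact: fc|exact: gc].
move=> u; have [du Du] := fd u; have [eu Eu] := gd u; split.
  by move=> x Ux; apply: derivableD; [exact: du|exact: eu].
apply: (Ck_ext oU _ (ih _ _ Du Eu)) => x Ux.
by rewrite deriveD//; [exact: du|exact: eu].
Qed.

Lemma CkM V k (U : set V) (f g : V -> R) : open U ->
  Ck k U f -> Ck k U g -> Ck k U (fun x => f x * g x).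
Proof.
move=> oU; elim: k f g => [|k ih] f g Cf Cg.
  have [[fc _] [gc _]] := (Cf, Cg).
  by split=> // x Ux; apply: cvgM; [exact: fc|exact: gc].
have [[fc fd] [gc gd]] := (Cf, Cg).
split; first by move=> x Ux; apply: cvgM; [exact: fc|exact: gc].
move=> u; have [du Du] := fd u; have [eu Eu] := gd u; split.
  by move=> x Ux; apply: derivableM; [exact: du|exact: eu].
apply: (Ck_ext oU _ (CkD oU (ih _ _ (CkS Cf) Eu) (ih _ _ (CkS Cg) Du))) => x Ux.
by rewrite deriveM//; [exact: du|exact: eu].
Qed.

Lemma Ck_sum V k (U : set V) I (r : seq I) (P : pred I) (f : I -> V -> R) :
  open U -> (forall i, P i -> Ck k U (f i)) ->
  Ck k U (fun x => \sum_(i <- r | P i) f i x).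
Proof.
move=> oU Cf; elim: r => [|i r ih].
  by apply: Ck_ext (Ck_cst k U (0 : R)) => // x _; rewrite big_nil.
case Pi : (P i); last by apply: Ck_ext ih => // x _; rewrite big_cons Pi.
by apply: Ck_ext (CkD oU (Cf _ Pi) ih) => // x _; rewrite big_cons Pi.
Qed.

Lemma Ck_prod V k (U : set V) I (r : seq I) (P : pred I) (f : I -> V -> R) :
  open U -> (forall i, P i -> Ck k U (f i)) ->
  Ck k U (fun x => \prod_(i <- r | P i) f i x).
Proof.
move=> oU Cf; elim: r => [|i r ih].
  by apply: Ck_ext (Ck_cst k U (1 : R)) => // x _; rewrite big_nil.
case Pi : (P i); last by apply: Ck_ext ih => // x _; rewrite big_cons Pi.
by apply: Ck_ext (CkM oU (Cf _ Pi) ih) => // x _; rewrite big_cons Pi.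
Qed.

(** The derivative of a linear form along u is the constant f u. *)
Lemma Ck_additive V k (U : set V) (f : V -> R) :
  (forall (t : R) x y, f (t *: x + y) = t * f x + f y) -> continuous f ->
  Ck k U f.
Proof.
move=> flin fc.
have fu u x : is_derive x u f (f u).
  have h : is_derive (0 : R) (1 : R) (fun t : R => f (t *: u + x)) (f u).
    have -> : (fun t : R => f (t *: u + x)) = (fun t => t *: f u) + cst (f x).
      by apply/funext => t; rewrite flin.
    rewrite -[X in is_derive _ _ _ X]addr0.
    exact: is_deriveD (is_derive_scalel 0 (f u)) (is_derive_cst _ _ _).
  case: h => h hE; split; first exact/derivable1P.
  by rewrite derive_line.
case: k => [|k]; split; do ?by move=> x _; exact: fc.
  by [].
move=> u; split; first by move=> x _; case: (fu u x).
have -> : (fun x => 'D_u f x) = cst (f u).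
  by apply/funext => x; case: (fu u x).
exact: Ck_cst.
Qed.

(** Induction on k through the chain rule: the derivative of g o f along u is the sum over i of D_u
    (co_i o f) times (D_(e_i) g) o f, and the second factors are compositions to which the induction
    hypothesis applies. Working with coordinates of f keeps everything scalar. *)
Lemma Ck_comp V W N (e : 'I_N -> W) (co : 'I_N -> W -> R) k
    (U : set V) (U' : set W) (f : V -> W) (g : W -> R) :
  coordinates e co -> open U -> open U' -> (forall x, U x -> U' (f x)) ->
  (forall i, Ck k U (co i \o f)) -> Ck k U' g -> Ck k U (g \o f).
Proof.
move=> eco oU oU' UU'; have [clin cc cE] := eco.
have fE : f = fun x => \sum_i co i (f x) *: e i by apply/funext => x.
have fc j : (forall i, Ck j U (co i \o f)) -> forall x, U x -> {for x, continuous f}.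
  move=> Cf x Ux.
  have : (fun y => \sum_i co i (f y) *: e i) @ x --> \sum_i co i (f x) *: e i.
    by apply: cvg_sumr => i _; apply: cvgZr_tmp; exact: Ck_continuous (Cf i) Ux.
  by rewrite -fE -cE.
elim: k g => [|k ih] g Cf Cg.
  split=> // x Ux; apply: continuous_comp; first exact: fc Cf _ Ux.
  by have [+ _] := Cg; apply; exact: UU'.
split.
  move=> x Ux; apply: continuous_comp; first exact: fc Cf _ Ux.
  by have [+ _] := Cg; apply; exact: UU'.
move=> u.
have fu x : U x -> is_derive x u f (\sum_i 'D_u (co i \o f) x *: e i).
  move=> Ux.
  have h i : is_derive x u (fun x => co i (f x) *: e i) ('D_u (co i \o f) x *: e i).
    apply: is_derive_scale; apply: DeriveDef => //.
    by have [_ /(_ u)[+ _]] := Cf i; apply.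
  have := is_derive_sum h; rewrite (_ : \sum_(i < N) _ = f) //.
  by apply/funext => y; rewrite fct_sumE [RHS]cE.
have gdiff y : U' y -> differentiable g y.
  by move=> U'y; apply: (C1_differentiable eco oU' _ U'y); exact: Ck_le Cg.
have gf x : U x ->
    is_derive x u (g \o f) (\sum_i 'D_u (co i \o f) x * 'D_(e i) g (f x)).
  move=> Ux; have := is_derive_chain (fu x Ux) (gdiff _ (UU' _ Ux)).
  rewrite deriveE; last exact/gdiff/UU'.
  rewrite linear_sum; congr is_derive; apply: eq_bigr => i _.
  by rewrite linearZZ -deriveE//; exact/gdiff/UU'.
split; first by move=> x Ux; case: (gf x Ux).
apply: (@Ck_ext _ _ _ _ (fun x => \sum_i 'D_u (co i \o f) x * 'D_(e i) g (f x))) => //.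
  by move=> x Ux; have [_ ->] := gf x Ux.
apply: Ck_sum => // i _; apply: CkM => //.
  by have [_ /(_ u)[_ +]] := Cf i.
by apply: (ih (fun y => 'D_(e i) g y)); [move=> j; exact: CkS|have [_ /(_ (e i))[_ +]] := Cg].
Qed.

End CkTheory.

Lemma near_openP (T : topologicalType) (p : T) (P : set T) :
  (\forall q \near p, P q) -> exists O, [/\ open O, O p & O `<=` P].
Proof.
by rewrite /prop_near1 nbhsE => -[ O [oO Op] OP]; exists O.
Qed.

(** * Smooth functions in coordinates, and calculus of matrix-valued functions *)

Section CoordinateSystems.
Variable R : realType.
Implicit Types (V W : normedModType R).

Lemma coordinates_real : coordinates (fun _ : 'I_1 => 1 : R) (fun _ => id).
Proof.
split=> //; first by move=> _ x; exact: cvg_id.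
by move=> x; rewrite big_ord1 [RHS]mulr1.
Qed.

Lemma coordinates_rV n :
  coordinates (fun i : 'I_n => delta_mx ord0 i : 'rV[R]_n)
              (fun i x => x ord0 i).
Proof.
split=> [i t x y|i|x]; first by rewrite !mxE.
  exact: coord_continuous.
exact: row_sum_delta.
Qed.

Lemma coordinates_prod V W N1 N2 (e1 : 'I_N1 -> V) co1 (e2 : 'I_N2 -> W) co2 :
  coordinates e1 co1 -> coordinates e2 co2 ->
  coordinates
    (fun i : 'I_(N1 + N2) =>
       match fintype.split i with
       | inl j => (e1 j, 0 : W) | inr j => (0 : V, e2 j) end)
    (fun i z => match fintype.split i with inl j => co1 j z.1 | inr j => co2 j z.2 end).
Proof.
move=> [l1 c1 E1] [l2 c2 E2]; split.
- by move=> i t x y; case: fintype.split => j; rewrite (l1, l2).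
- move=> i z; case: fintype.split => j.
    by apply: (@continuous_comp _ _ _ fst (co1 j)); [exact: cvg_fst|exact: c1].
  by apply: (@continuous_comp _ _ _ snd (co2 j)); [exact: cvg_snd|exact: c2].
- move=> [x y]; rewrite big_split_ord /=.
  under eq_bigr do rewrite (unsplitK (inl _)) /=.
  under [X in _ = _ + X]eq_bigr do rewrite (unsplitK (inr _)) /=.
  rewrite [in LHS](E1 x) [in LHS](E2 y).
  apply/eqP; rewrite xpair_eqE /=; apply/andP; split; apply/eqP.
    rewrite (big_morph fst (id1 := 0) (op1 := +%R))// .
    rewrite (big_morph fst (id1 := 0) (op1 := +%R))//= .
    by rewrite [X in _ + X]big1 ?addr0// => i _; rewrite scaler0.
  rewrite (big_morph snd (id1 := 0) (op1 := +%R))// .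
  rewrite (big_morph snd (id1 := 0) (op1 := +%R))//= .
  by rewrite [X in X + _]big1 ?add0r// => i _; rewrite scaler0.
Qed.

Lemma smooth_ext V W (U : set V) (f g : V -> W) : open U ->
  (forall x, U x -> f x = g x) -> smooth_on U f -> smooth_on U g.
Proof. by move=> oU fg sf k; exact: Ck_ext (sf k). Qed.

Lemma smooth_local V W (U : set V) (f : V -> W) :
  (forall x, U x -> exists2 U' : set V, U' x & smooth_on U' f) -> smooth_on U f.
Proof.
by move=> loc k; apply: Ck_local => x /loc[U' U'x sf]; exists U'.
Qed.

Lemma smooth_mono V W (U U' : set V) (f : V -> W) :
  U `<=` U' -> smooth_on U' f -> smooth_on U f.
Proof. by move=> UU' sf k; exact: Ck_mono UU' (sf k). Qed.

Lemma smooth_cst V W (U : set V) (w : W) : smooth_on U (cst w).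
Proof. by move=> k; exact: Ck_cst. Qed.

Lemma smoothD V W (U : set V) (f g : V -> W) : open U ->
  smooth_on U f -> smooth_on U g -> smooth_on U (fun x => f x + g x).
Proof. by move=> oU sf sg k; exact: CkD. Qed.

Lemma smoothM V (U : set V) (f g : V -> R) : open U ->
  smooth_on U f -> smooth_on U g -> smooth_on U (fun x => f x * g x).
Proof. by move=> oU sf sg k; exact: CkM. Qed.

Lemma smooth_sum V (U : set V) I (r : seq I) (P : pred I) (f : I -> V -> R) :
  open U -> (forall i, P i -> smooth_on U (f i)) ->
  smooth_on U (fun x => \sum_(i <- r | P i) f i x).
Proof. by move=> oU sf k; apply: Ck_sum => // i Pi; exact: sf. Qed.

Lemma smooth_prod V (U : set V) I (r : seq I) (P : pred I) (f : I -> V -> R) :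
  open U -> (forall i, P i -> smooth_on U (f i)) ->
  smooth_on U (fun x => \prod_(i <- r | P i) f i x).
Proof. by move=> oU sf k; apply: Ck_prod => // i Pi; exact: sf. Qed.

Lemma smooth_derive V W (U : set V) (f : V -> W) u :
  smooth_on U f -> smooth_on U (fun x => 'D_u f x).
Proof. by move=> sf k; have [_ /(_ u)[_ +]] := sf k.+1. Qed.

Lemma smooth_continuous V W (U : set V) (f : V -> W) x :
  smooth_on U f -> U x -> {for x, continuous f}.
Proof. by move=> /(_ 0%N); exact: Ck_continuous. Qed.

Lemma smooth_comp V W N (e : 'I_N -> W) (co : 'I_N -> W -> R)
    (U : set V) (U' : set W) (f : V -> W) (g : W -> R) :
  coordinates e co -> open U -> open U' -> (forall x, U x -> U' (f x)) ->
  (forall i, smooth_on U (co i \o f)) -> smooth_on U' g -> smooth_on U (g \o f).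
Proof.
by move=> eco oU oU' UU' sf sg k; apply: (Ck_comp eco oU oU' UU') => // i; exact: sf.
Qed.

Lemma smooth_differentiable V N (e : 'I_N -> V) (co : 'I_N -> V -> R)
    (U : set V) (f : V -> R) x :
  coordinates e co -> open U -> smooth_on U f -> U x -> differentiable f x.
Proof. by move=> eco oU sf Ux; apply: (C1_differentiable eco oU (sf 1%N) Ux). Qed.

Lemma smooth_additive V (U : set V) (f : V -> R) :
  (forall (t : R) x y, f (t *: x + y) = t * f x + f y) -> continuous f ->
  smooth_on U f.
Proof. by move=> fl fc k; exact: Ck_additive. Qed.

Lemma smooth_coord V N (e : 'I_N -> V) (co : 'I_N -> V -> R) (U : set V) i :
  coordinates e co -> smooth_on U (co i).
Proof. by move=> [l c _]; exact: smooth_additive. Qed.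

Section Matrices.
Variables (V : normedModType R) (m n : nat).
Implicit Types (U : set V) (f : V -> 'M[R]_(m, n)).

Lemma cvg_mxP T (F : set_system T) (g : T -> 'M[R]_(m, n)) (l : 'M[R]_(m, n)) :
  Filter F ->
  (forall i j, g x i j @[x --> F] --> l i j) -> g x @[x --> F] --> l.
Proof.
move=> FF h; rewrite [l in _ --> l]matrix_sum_delta.
have -> : g = fun x => \sum_i \sum_j g x i j *: delta_mx i j.
  by apply/funext => x; exact: matrix_sum_delta.
apply: cvg_sumr => i _; apply: cvg_sumr => j _; apply: cvgZr_tmp; exact: h.
Qed.

Lemma continuous_entry f x i j :
  {for x, continuous f} -> {for x, continuous (fun y => f y i j)}.
Proof.
move=> fc; apply: (@continuous_comp _ _ _ f (fun N : 'M[R]_(m, n) => N i j)) => //.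
exact: coord_continuous.
Qed.

Lemma Ck_mxP k U f : open U ->
  Ck k U f <-> forall i j, Ck k U (fun x => f x i j).
Proof.
move=> oU; split.
  elim: k f => [|k ih] f [fc fd] i j.
    by split=> // x Ux; apply: continuous_entry; exact: fc.
  split; first by move=> x Ux; apply: continuous_entry; exact: fc.
  move=> u; have [du Du] := fd u; split.
    by move=> x Ux; apply: (derivable_mxP _ _ _).1; exact: du.
  apply: (Ck_ext oU _ (ih _ Du i j)) => x Ux.
  by rewrite (derive_mx (du x Ux)) mxE.
elim: k f => [|k ih] f h.
  by split=> // x Ux; apply: cvg_mxP => i j; have [+ _] := h i j; apply.
split; first by move=> x Ux; apply: cvg_mxP => i j; have [+ _] := h i j; apply.
have dfu u x : U x -> derivable f x u.
  move=> Ux; apply/derivable_mxP => i j.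
  by have [_ /(_ u)[+ _]] := h i j; apply.
move=> u; split; first exact: dfu.
apply: ih => i j; have [_ /(_ u)[_ hD]] := h i j.
by apply: (Ck_ext oU _ hD) => x Ux; rewrite (derive_mx (dfu _ _ Ux)) mxE.
Qed.

Lemma smooth_mxP U f : open U ->
  smooth_on U f <-> forall i j, smooth_on U (fun x => f x i j).
Proof.
move=> oU; split=> [sf i j k|sf k].
  exact: (Ck_mxP k f oU).1.
by apply/(Ck_mxP k f oU) => i j; exact: sf.
Qed.

Lemma differentiable_mx f x :
  (forall i j, differentiable (fun y => f y i j) x) -> differentiable f x.
Proof.
move=> h; have -> : f = \sum_i \sum_j (fun y => f y i j *: delta_mx i j).
  apply/funext => y; rewrite fct_sumE [LHS]matrix_sum_delta.
  by apply: eq_bigr => i _; rewrite fct_sumE.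
apply: differentiable_sum => i; apply: differentiable_sum => j.
exact: differentiableZl.
Qed.

Lemma smooth_differentiable_mx N (e : 'I_N -> V) (co : 'I_N -> V -> R) U f x :
  coordinates e co -> open U -> smooth_on U f -> U x -> differentiable f x.
Proof.
move=> eco oU /(smooth_mxP f oU) sf Ux; apply: differentiable_mx => i j.
exact: (smooth_differentiable eco oU (sf i j) Ux).
Qed.

Lemma is_derive_mxP f x v d :
  is_derive x v f d <-> forall i j, is_derive x v (fun y => f y i j) (d i j).
Proof.
split=> [[h1 h2] i j|h].
  split; first exact: (derivable_mxP _ _ _).1.
  by move: h2; rewrite (derive_mx h1) => <-; rewrite mxE.
have df : derivable f x v by apply/derivable_mxP => i j; case: (h i j).
split=> //; rewrite (derive_mx df); apply/matrixP => i j; rewrite mxE.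
by case: (h i j).
Qed.
End Matrices.

Lemma is_derive_sumr V W (I : Type) (r : seq I) (P : pred I) (f : I -> V -> W)
    x v (d : I -> W) :
  (forall i, P i -> is_derive x v (f i) (d i)) ->
  is_derive x v (fun y => \sum_(i <- r | P i) f i y) (\sum_(i <- r | P i) d i).
Proof.
move=> h; elim: r => [|i r ih].
  rewrite big_nil; have -> : (fun y => \sum_(i <- [::] | P i) f i y) = cst (0 : W).
    by apply/funext => y; rewrite big_nil.
  exact: is_derive_cst.
rewrite big_cons; case Pi : (P i).
  have -> : (fun y => \sum_(j <- i :: r | P j) f j y) =
      f i + (fun y => \sum_(j <- r | P j) f j y).
    by apply/funext => y; rewrite big_cons Pi.
  exact: is_deriveD (h _ Pi) ih.
rewrite (_ : (fun y => _) = (fun y => \sum_(j <- r | P j) f j y)) //.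
by apply/funext => y; rewrite big_cons Pi.
Qed.

Lemma is_derive_mul V (f g : V -> R) x v (a b : R) :
  is_derive x v f a -> is_derive x v g b ->
  is_derive x v (fun y => f y * g y) (a * g x + f x * b).
Proof.
move=> df dg; have := is_deriveM df dg.
by rewrite addrC /GRing.scale /= [g x * a]mulrC.
Qed.

Lemma is_derive_mulmx V m p q (A : V -> 'M[R]_(m, p)) (B : V -> 'M[R]_(p, q))
    x v dA dB :
  is_derive x v A dA -> is_derive x v B dB ->
  is_derive x v (fun y => A y *m B y) (dA *m B x + A x *m dB).
Proof.
move=> /is_derive_mxP hA /is_derive_mxP hB; apply/is_derive_mxP => i j.
rewrite !mxE -big_split /=.
have -> : (fun y => (A y *m B y) i j) = fun y => \sum_k A y i k * B y k j.
  by apply/funext => y; rewrite mxE.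
by apply: is_derive_sumr => k _; exact: is_derive_mul.
Qed.

Lemma is_derive_pair V W (Y : normedModType R) (f : V -> W) (g : V -> Y) x v a b :
  is_derive x v f a -> is_derive x v g b ->
  is_derive x v (fun y => (f y, g y)) (a, b).
Proof.
move=> /is_derive_lineP [/derivable1_diffP df fE].
move=> /is_derive_lineP [/derivable1_diffP dg gE]; apply/is_derive_lineP.
have dfg := differentiable_pair df dg.
split; first exact/derivable1_diffP.
by rewrite deriveE// diff_pair//= -fE -gE !deriveE.
Qed.

Lemma is_derive_diff V W (f : V -> W) x v :
  differentiable f x -> is_derive x v f ('D_v f x).
Proof. by move=> df; apply: derivableP; exact: diff_derivable. Qed.

Lemma derive_entry V m n
    (f : V -> 'M[R]_(m, n)) x v i j : differentiable f x ->
  'D_v f x i j = 'D_v (fun y => f y i j) x.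
Proof.
by move=> df; have [h _] := is_derive_diff v df; rewrite (derive_mx h) mxE.
Qed.

(** Most identities for the derivation are obtained from this: both sides are exhibited as
    derivatives at 0 of one and the same function. *)
Lemma is_derive_unique V W (f : V -> W) x u a b :
  is_derive x u f a -> is_derive x u f b -> a = b.
Proof. by move=> [_ <-] [_ <-]. Qed.

Lemma is_derive_affine V (a b : V) :
  is_derive (0 : R) (1 : R) (fun t : R => a + t *: b) b.
Proof.
have := is_deriveD (is_derive_cst a (0 : R) (1 : R)) (is_derive_scalel 0 b).
by rewrite add0r.
Qed.

Lemma is_derive_covector n m (G : 'M[R]_n) (a : 'M[R]_(n, m)) :
  is_derive (0 : R) (1 : R) (fun t : R => (1%:M + t *: G) *m a) (G *m a).
Proof.
have := is_derive_mulmx (is_derive_affine 1%:M G)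
  (is_derive_cst a (0 : R) (1 : R)).
by rewrite mulmx0 addr0.
Qed.

Lemma is_derive_vector n m (G : 'M[R]_n) (x : 'M[R]_(m, n)) :
  is_derive (0 : R) (1 : R) (fun t : R => x *m (1%:M + t *: G)) (x *m G).
Proof.
have := is_derive_mulmx (is_derive_cst x (0 : R) (1 : R))
  (is_derive_affine 1%:M G).
by rewrite mul0mx add0r.
Qed.

Lemma derive_coordinates V N (e : 'I_N -> V)
    (co : 'I_N -> V -> R) (f : V -> R) x u :
  coordinates e co -> differentiable f x ->
  'D_u f x = \sum_i co i u * 'D_(e i) f x.
Proof.
move=> [_ _ E] df; rewrite {1}[u]E deriveE// linear_sum.
by apply: eq_bigr => i _; rewrite linearZZ -deriveE.
Qed.

Lemma open_base n (U : set 'rV[R]_n) : open U ->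
  open [set z : 'rV[R]_n * 'rV[R]_n | U z.1].
Proof. by move=> oU; apply: open_comp => // z _; exact: cvg_fst. Qed.

Lemma smooth_base n (U : set 'rV[R]_n) (f : 'rV[R]_n -> R) : open U ->
  smooth_on U f ->
  smooth_on [set z : 'rV[R]_n * 'rV[R]_n | U z.1] (fun z => f z.1).
Proof.
move=> oU sf; apply: (smooth_comp (U' := U) (f := fst) (coordinates_rV n)) => //.
  exact: open_base.
move=> i; apply: smooth_additive; first by move=> t x y; rewrite /= !mxE.
move=> z; apply: (@continuous_comp _ _ _ fst (fun x : 'rV[R]_n => x ord0 i)).
  exact: cvg_fst.
exact: coord_continuous.
Qed.

Lemma smooth_fibre_coord n (U : set ('rV[R]_n * 'rV[R]_n)) i :
  smooth_on U (fun z => z.2 ord0 i).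
Proof.
apply: smooth_additive; first by move=> t x y; rewrite /= !mxE.
move=> z; apply: (@continuous_comp _ _ _ snd (fun x : 'rV[R]_n => x ord0 i)).
  exact: cvg_snd.
exact: coord_continuous.
Qed.

End CoordinateSystems.

(** * Bump functions *)

Section FlatFunction.
Variable R : realType.

(* The derivatives of exp(-1/t) are linear combinations of these functions. *)
Definition flat (m : nat) (t : R) : R :=
  if 0 < t then t^-1 ^+ m * expR (- t^-1) else 0.

Lemma flat_le0 m t : t <= 0 -> flat m t = 0.
Proof. by move=> t0; rewrite /flat ltNge t0. Qed.

(** With m = k + 1, exp(s) = exp(s / m)^m, and exp(y) >= 1 + y >= y at y = s / m. *)
Lemma expRN_pow_le (k : nat) (s : R) : 0 < s ->
  s ^+ k.+1 * expR (- s) <= k.+1%:R ^+ k.+1.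
Proof.
move=> s0; rewrite expRN ler_pdivrMr ?expR_gt0//.
have k0 : 0 < k.+1%:R :> R by rewrite ltr0n.
have -> : s = (s / k.+1%:R) *+ k.+1.
  by rewrite -[_ *+ _]mulr_natr divfK// gt_eqF.
rewrite -[in expR _]mulr_natl expRM_natl -exprMn.
apply: lerXn2r; rewrite ?nnegrE ?mulr_ge0 ?expR_ge0//.
  by rewrite mulrn_wge0// divr_ge0// ltW.
rewrite -mulr_natl ler_wpM2l//.
by apply: le_trans (expR_ge1Dx _); rewrite ler_wpDl.
Qed.

(** Two powers of 1/t are traded for the factor t^2, so that the difference quotients at 0 still
    tend to 0. *)
Lemma flat_bound m t : `|flat m t| <= m.+2%:R ^+ m.+2 * t ^+ 2.
Proof.
rewrite /flat; case: ltP => t0; last first.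
  by rewrite normr0 mulr_ge0// ?sqr_ge0// exprn_ge0.
have s0 : 0 < t^-1 by rewrite invr_gt0.
have /ger0_norm -> : 0 <= t^-1 ^+ m * expR (- t^-1).
  by rewrite mulr_ge0 ?expR_ge0// exprn_ge0// ltW.
have -> : t^-1 ^+ m * expR (- t^-1) =
    t^-1 ^+ m.+2 * expR (- t^-1) * t ^+ 2.
  by rewrite !exprS; move: (t^-1 ^+ m) (expR _) => p q; field; rewrite gt_eqF.
by rewrite ler_wpM2r ?sqr_ge0// expRN_pow_le.
Qed.

(** For t > 0, differentiate s^m exp(-s) at s = 1/t, with ds/dt = - s^2. At 0 the quadratic bound
    [flat_bound] makes the derivative vanish. *)
Lemma is_derive_flat m (t : R) :
  is_derive t (1 : R) (flat m) (flat m.+2 t - m%:R * flat m.+1 t).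
Proof.
have [t0|t0|t0] := ltgtP t 0.
- have -> : flat m.+2 t - m%:R * flat m.+1 t = 0.
    by rewrite !flat_le0 ?ltW// mulr0 subrr.
  apply: (near_eq_is_derive _ (is_derive_cst (0 : R) t 1)).
  near=> y; rewrite flat_le0// ltW//; near: y.
  exact: lt_nbhsl.
- pose g (s : R) : R := s ^+ m * expR (- s).
  have dg (s : R) : is_derive s (1 : R) g
      (m%:R * s ^+ m.-1 * expR (- s) + s ^+ m * - expR (- s)).
    apply: is_derive_mul.
      have -> : (fun y : R => y ^+ m) = (id : R -> R) ^+ m.
        by apply/funext => y; rewrite exprfctE.
      by have := is_deriveX m (is_derive_id s (1 : R)); rewrite [_ *: 1]mulr1.
    have [dexp Dexp] := is_derive_expR (- s).
    have diffexp : differentiable (@expR R) (- s) by exact/derivable1_diffP.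
    have := is_derive_chain (is_deriveNid s (1 : R)) diffexp.
    rewrite (derive_dir1 (-1) diffexp).
    rewrite Dexp.
    rewrite [_ *: _]mulN1r.
    exact.
  have dgs (s : R) : differentiable g s.
    by have [h _] := dg s; exact/derivable1_diffP.
  have dg' := dgs t^-1.
  have dV : is_derive t (1 : R) (fun y : R => y^-1) (- t ^- 2).
    have tn0 : t != 0 by rewrite gt_eqF.
    have idd := @derivable_id R R t 1.
    have vd := @derivableV R R id t 1 tn0 idd.
    have vE := @deriveV R R id t 1 tn0 idd.
    rewrite derive_id [_ *: _]mulr1 in vE.
    by split.
  have := is_derive_chain (f := fun y : R => y^-1) (g := g) dV dg'.
  rewrite derive_dir1// (@derive_val _ _ _ _ _ _ _ (dg _)) => h.
  have near_g : \forall y \near t, (g \o (fun y => y^-1)) y = flat m y.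
    near=> y; have y0 : 0 < y by near: y; exact: lt_nbhsr.
    by rewrite /flat y0.
  have := near_eq_is_derive near_g h; congr is_derive.
  rewrite /flat t0 /GRing.scale /= -exprVn.
  (* The exponent [m.-1] is truncated at m = 0, where its coefficient m vanishes. *)
  case: m {dg dgs dg' near_g h g} => [|m] /=.
    by rewrite !expr0 !expr1 !mul0r; ring.
  by rewrite !exprS; move: (t^-1 ^+ m) => ?; ring.
- subst t.
  have -> : flat m.+2 0 - m%:R * flat m.+1 0 = 0.
    by rewrite !flat_le0// mulr0 subrr.
  (* By [flat_bound] the quotient is at most a constant times |h|. *)
  have h : h^-1 *: (flat m (h *: 1 + 0) - flat m 0) @[h --> 0^'] --> (0 : R).
    apply/cvgr0Pnorm_le => _/posnumP[eps].
    have C0 : 0 < m.+2%:R ^+ m.+2 :> R by rewrite exprn_gt0// ltr0n.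
    near=> h.
    have h0 : h != 0 by near: h; exact: nbhs_dnbhs_neq.
    rewrite (@flat_le0 m 0)// subr0 addr0 scaler1 normrZ normfV.
    rewrite mulrC ler_pdivrMr ?normr_gt0//.
    apply: le_trans (flat_bound _ _) _.
    rewrite -real_normK ?num_real// expr2 mulrA ler_wpM2r// -ler_pdivlMl//.
    near: h; apply: dnbhs0_le; by rewrite mulr_gt0// invr_gt0.
  split; first by apply/cvg_ex; exists 0.
  exact/cvg_lim.
Unshelve. all: by end_near. Qed.

(** The induction on the order runs over all m simultaneously, since one derivative of [flat m]
    involves the indices m + 1 and m + 2. *)
Lemma smooth_flat m : smooth_on setT (flat m).
Proof.
move=> k; elim: k m => [|k ih] m.
  split=> // t _; apply: differentiable_continuous.
  by have [h _] := is_derive_flat m t; exact/derivable1_diffP.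
have df t : differentiable (flat m) t.
  by have [h _] := is_derive_flat m t; exact/derivable1_diffP.
split; first by move=> t _; exact: differentiable_continuous.
move=> u; split; first by move=> t _; exact: diff_derivable.
have -> : (fun t => 'D_u (flat m) t) =
    (fun t => u * (flat m.+2 t + - m%:R * flat m.+1 t)).
  apply/funext => t; rewrite derive_dir1//.
  by rewrite (@derive_val _ _ _ _ _ _ _ (is_derive_flat m t)) mulNr.
apply: CkM; [exact: openT|exact: Ck_cst|].
apply: CkD; [exact: openT|exact: ih|].
by apply: CkM; [exact: openT|exact: Ck_cst|exact: ih].
Qed.

(* The inner flat function makes the argument constant for t <= 0, which
   yields a plateau without any division by a function. *)
Definition plateau (t : R) : R :=
  (flat 0 1)^-1 * flat 0 (1 - (flat 0 1)^-1 * flat 0 t).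

Lemma flat1_gt0 : 0 < flat 0 1.
Proof. by rewrite /flat ltr01 expr0 mul1r expR_gt0. Qed.

Lemma plateau_le0 t : t <= 0 -> plateau t = 1.
Proof.
move=> t0; rewrite /plateau (@flat_le0 0 t)// mulr0 subr0 mulVf// gt_eqF//.
exact: flat1_gt0.
Qed.

(** On the half-line from 1 on, [flat 0] is at least [flat 0 1], so the argument of the outer flat
    function is nonpositive. *)
Lemma plateau_ge1 t : 1 <= t -> plateau t = 0.
Proof.
move=> t1; have t0 : 0 < t by exact: lt_le_trans ltr01 t1.
rewrite /plateau (@flat_le0 0 (1 - _)) ?mulr0// subr_le0.
rewrite ler_pdivlMl ?flat1_gt0// mulr1 /flat ltr01 t0 !expr0 !mul1r.
by rewrite ler_expR lerN2 invr1 invf_le1.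
Qed.

Lemma smooth_plateau : smooth_on setT plateau.
Proof.
apply: smoothM; [exact: openT|exact: smooth_cst|].
apply: (smooth_comp (U' := setT) (coordinates_real R)) => //; first exact: openT.
- exact: openT.
- move=> _ /=; apply: smoothD; [exact: openT|exact: smooth_cst|].
  have -> : (fun x => - ((flat 0 1)^-1 * flat 0 x)) =
      (fun x => - (flat 0 1)^-1 * flat 0 x).
    by apply/funext => x; rewrite mulNr.
  by apply: smoothM; [exact: openT|exact: smooth_cst|exact: smooth_flat].
- exact: smooth_flat.
Qed.

Lemma bump_rV n (O : set 'rV[R]_n) (a : 'rV[R]_n) : open O -> O a ->
  exists b : 'rV[R]_n -> R,
    [/\ smooth_on setT b, (\forall x \near a, b x = 1) &
        exists K, [/\ compact K, K `<=` O & forall x, ~ K x -> b x = 0]].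
Proof.
move=> oO Oa.
have /nbhs_ballP[r /= r0 rO] : nbhs a O by exact: open_nbhs_nbhs.
(* The support will lie in the closed cube of half-side 2 eps = r / 2, inside the ball of radius
   r. *)
pose eps := r / 4; have e0 : 0 < eps by rewrite divr_gt0.
(* A squared Euclidean distance keeps q smooth, which the sup norm would not. It equals -1 at a, and
   is at least 3 outside the cube, where one coordinate differs from that of a by more than 2 eps;
   so [plateau] is 1 near a and 0 off the cube. *)
pose q (x : 'rV[R]_n) := eps ^- 2 * (\sum_i (x ord0 i - a ord0 i) ^+ 2) + -1.
have sq : smooth_on setT q.
  apply: smoothD; [exact: openT| |exact: smooth_cst].
  apply: smoothM; [exact: openT|exact: smooth_cst|].
  apply: smooth_sum; first exact: openT.
  move=> i _; have -> : (fun x : 'rV[R]_n => (x ord0 i - a ord0 i) ^+ 2) =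
    fun x => (x ord0 i + - a ord0 i) * (x ord0 i + - a ord0 i).
    by apply/funext => x; rewrite expr2.
  have h : smooth_on setT (fun x : 'rV[R]_n => x ord0 i + - a ord0 i).
    apply: smoothD; [exact: openT| |exact: smooth_cst].
    exact: (smooth_coord _ i (coordinates_rV R n)).
  by apply: smoothM => //; exact: openT.
exists (plateau \o q); split.
- apply: (smooth_comp (U' := setT) (coordinates_real R)) => //.
  + exact: openT.
  + exact: openT.
  + exact: smooth_plateau.
- have qa : q a < 0.
    rewrite /q big1 ?mulr0 ?add0r ?ltrN10// => i _.
    by rewrite subrr expr0n.
  have qc : q @ a --> q a by apply: (smooth_continuous sq).
  have : \forall x \near a, q x < 0 by exact: qc (lt_nbhsl qa).
  apply: filterS => x qx /=.
  by rewrite plateau_le0// ltW.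
pose I i : set R := `[a ord0 i - eps *+ 2, a ord0 i + eps *+ 2]%classic.
exists [set x : 'rV[R]_n | forall i, I i (x ord0 i)]; split.
- by apply: (@rV_compact R n I) => i; exact: segment_compact.
- move=> x Kx; apply: rO; split=> // i j; rewrite ord1 -ball_normE /=.
  have := Kx j; rewrite /I /= in_itv /= => h.
  rewrite distrC (@le_lt_trans _ _ (eps *+ 2))//; first by rewrite ler_distl.
  by rewrite /eps; lra.
- move=> x /existsNP[i]; rewrite /I /= in_itv /= => hi.
  rewrite /= plateau_ge1// /q -lerBlDr opprK -ler_pdivrMl; last first.
    by rewrite invr_gt0 exprn_gt0.
  rewrite invrK (bigD1 i)//= ler_wpDr//.
    by apply: sumr_ge0 => j _; exact: sqr_ge0.
  have : eps *+ 2 < `|x ord0 i - a ord0 i|.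
    by rewrite ltNge ler_distl; apply/negP.
  move=> h; rewrite -[leRHS]real_normK ?num_real//.
  by have := e0; move: h; move: (`|_|) => y; nra.
Qed.

End FlatFunction.

(** * Charts and tangent vectors *)

Section ChartCalculus.
Variables (R : realType) (n : nat) (M : manifold R n).
Implicit Types (c d e : chart R n M) (p : M) (w : 'rV[R]_n).

Lemma chart_map_cod c p : chart_dom c p -> chart_cod c (chart_map c p).
Proof. by move=> cp; exists p. Qed.

Lemma chart_inv_dom c x : chart_cod c x -> chart_dom c (chart_inv c x).
Proof. by move=> [p cp <-]; rewrite chart_mapK. Qed.

Lemma chart_invK c x : chart_cod c x -> chart_map c (chart_inv c x) = x.
Proof. by move=> [p cp <-]; rewrite chart_mapK. Qed.

Lemma chart_map_cvg c p : chart_dom c p -> {for p, continuous (chart_map c)}.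
Proof.
move=> cp; have := @chart_map_continuous _ _ _ c.
by rewrite continuous_open_subspace; [apply; rewrite inE|exact: chart_dom_open].
Qed.

Lemma chart_inv_cvg c x : chart_cod c x -> {for x, continuous (chart_inv c)}.
Proof.
move=> cx; have := @chart_inv_continuous _ _ _ c.
by rewrite continuous_open_subspace; [apply; rewrite inE|exact: chart_cod_open].
Qed.

Lemma near_chart c p (P : set M) : chart_dom c p ->
  (\forall q \near p, P q) ->
  \forall x \near chart_map c p, chart_cod c x /\ P (chart_inv c x).
Proof.
move=> cp Pp; have cx := chart_map_cod cp.
apply: filterI; first exact: open_nbhs_nbhs (conj (@chart_cod_open _ _ _ c) cx).
by apply: (chart_inv_cvg cx); rewrite chart_mapK.
Qed.

Lemma near_point c p (P : set 'rV[R]_n) : chart_dom c p ->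
  (\forall x \near chart_map c p, P x) ->
  \forall q \near p, chart_dom c q /\ P (chart_map c q).
Proof.
move=> cp Pp.
apply: filterI; first exact: open_nbhs_nbhs (conj (@chart_dom_open _ _ _ c) cp).
exact: chart_map_cvg.
Qed.

Lemma open_chart_set c (O : set M) : open O -> open (chart_set c O).
Proof.
move=> oO; rewrite openE => x [cx Ox]; rewrite /interior.
have cp := chart_inv_dom cx.
have := near_chart cp (open_nbhs_nbhs (conj oO Ox)).
by rewrite chart_invK.
Qed.

Lemma chart_setT c : chart_set c setT = chart_cod c.
Proof. by apply/seteqP; split=> [x []|x]. Qed.

Lemma overlap_open c d : open (chart_set c (chart_dom d)).
Proof. by apply: open_chart_set; exact: chart_dom_open. Qed.

Lemma overlap_map c d p : chart_dom c p -> chart_dom d p ->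
  chart_set c (chart_dom d) (chart_map c p).
Proof. by move=> cp dp; split; [exact: chart_map_cod|rewrite chart_mapK]. Qed.

Section Transitions.
Variables (c d : chart R n M).
Hypotheses (ac : atlas c) (ad : atlas d).

Lemma smooth_transition :
  smooth_on (chart_set c (chart_dom d)) (fun x => chart_map d (chart_inv c x)).
Proof. exact: atlas_smooth. Qed.

Lemma transition_differentiable p : chart_dom c p -> chart_dom d p ->
  differentiable (fun x => chart_map d (chart_inv c x)) (chart_map c p).
Proof.
move=> cp dp.
apply: (smooth_differentiable_mx (U := chart_set c (chart_dom d))
  (coordinates_rV R n)).
- exact: overlap_open.
- exact: smooth_transition.
- exact: overlap_map.
Qed.

(** The Jacobian of the transition from c to d, acting on row vectors from the right; products of
    Jacobians are thus read from left to right. *)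
Definition change_mx c d p : 'M[R]_n :=
  \matrix_i chart_change c d p (delta_mx ord0 i).

Lemma chart_changeE p w : chart_dom c p -> chart_dom d p ->
  chart_change c d p w = w *m change_mx c d p.
Proof.
move=> cp dp; have df := transition_differentiable cp dp.
rewrite mulmx_sum_row {1}[w]row_sum_delta /chart_change deriveE// linear_sum.
by apply: eq_bigr => i _; rewrite linearZZ rowK /chart_change deriveE.
Qed.

Lemma smooth_change_mx i j :
  smooth_on (chart_set c (chart_dom d))
    (fun x => change_mx c d (chart_inv c x) i j).
Proof.
have oW := @overlap_open c d.
have := smooth_derive (delta_mx ord0 i) smooth_transition.
move=> /(smooth_mxP _ oW)/(_ ord0 j); apply: smooth_ext => // x [cx dx].
by rewrite mxE /chart_change chart_invK.
Qed.

End Transitions.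

Lemma change_mx_id c p : atlas c -> chart_dom c p -> change_mx c c p = 1%:M.
Proof.
move=> ac cp; apply/row_matrixP => i; rewrite rowK row1 /chart_change.
have -> : 'D_(delta_mx ord0 i) (fun x => chart_map c (chart_inv c x)) (chart_map c p)
    = 'D_(delta_mx ord0 i) id (chart_map c p).
  apply: near_eq_derive; apply: filterS (near_chart cp filterT) => x [cx _].
  exact: chart_invK.
by rewrite derive_id.
Qed.

Lemma change_mxM c d e p : atlas c -> atlas d -> atlas e ->
  chart_dom c p -> chart_dom d p -> chart_dom e p ->
  change_mx c d p *m change_mx d e p = change_mx c e p.
Proof.
move=> ac ad ae cp dp ep; apply/row_matrixP => i.
rewrite row_mul rowK rowK -(chart_changeE ad ae _ dp ep) /chart_change.
set f := (fun x => chart_map d (chart_inv c x)).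
set g := (fun x => chart_map e (chart_inv d x)).
have df : differentiable f (chart_map c p) by exact: transition_differentiable.
have dg : differentiable g (f (chart_map c p)).
  by rewrite /f chart_mapK//; exact: transition_differentiable.
have -> : 'D_(delta_mx ord0 i) (fun x => chart_map e (chart_inv c x)) (chart_map c p)
    = 'D_(delta_mx ord0 i) (g \o f) (chart_map c p).
  apply: near_eq_derive.
  apply: filterS (open_nbhs_nbhs (conj (@overlap_open c d) (overlap_map cp dp))).
  by move=> x [cx dx]; rewrite /f /g /= chart_mapK.
have [_ ->] := is_derive_chain (is_derive_diff (delta_mx ord0 i) df) dg.
by rewrite /f chart_mapK.
Qed.

Lemma change_mxV c d p : atlas c -> atlas d -> chart_dom c p -> chart_dom d p ->
  change_mx c d p *m change_mx d c p = 1%:M.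
Proof. by move=> *; rewrite change_mxM// change_mx_id. Qed.

Lemma to_chartE c p w : atlas c -> chart_dom c p ->
  to_chart c p w = w *m change_mx (chart_at p) c p.
Proof.
move=> ac cp.
exact: (chart_changeE (chart_at_atlas p) ac w (chart_at_dom p) cp).
Qed.

Lemma of_chartE c p w : atlas c -> chart_dom c p ->
  of_chart c p w = w *m change_mx c (chart_at p) p.
Proof.
move=> ac cp.
exact: (chart_changeE ac (chart_at_atlas p) w cp (chart_at_dom p)).
Qed.

Lemma to_chartK c p w : atlas c -> chart_dom c p ->
  of_chart c p (to_chart c p w) = w.
Proof.
move=> ac cp; have ap := chart_at_atlas p; have dp := chart_at_dom p.
by rewrite (to_chartE _ ac cp) (of_chartE _ ac cp) -mulmxA
  (change_mxV ap ac dp cp) mulmx1.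
Qed.

Lemma of_chartK c d p w : atlas c -> atlas d -> chart_dom c p -> chart_dom d p ->
  to_chart d p (of_chart c p w) = w *m change_mx c d p.
Proof.
move=> ac ad cp dp; have ap := chart_at_atlas p; have pp := chart_at_dom p.
by rewrite (to_chartE _ ad dp) (of_chartE _ ac cp) -mulmxA
  (change_mxM ac ap ad cp pp dp).
Qed.

Lemma to_chart_at p w : to_chart (chart_at p) p w = w.
Proof.
have ap := chart_at_atlas p; have dp := chart_at_dom p.
by rewrite (to_chartE _ ap dp) (change_mx_id ap dp) mulmx1.
Qed.

Lemma of_chart_at p w : of_chart (chart_at p) p w = w.
Proof.
have ap := chart_at_atlas p; have dp := chart_at_dom p.
by rewrite (of_chartE _ ap dp) (change_mx_id ap dp) mulmx1.
Qed.

Lemma coord_vecE c p i : atlas c -> chart_dom c p ->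
  coord_vec c p i = delta_mx ord0 i *m change_mx c (chart_at p) p.
Proof. by move=> ac cp; exact: of_chartE. Qed.

Lemma coord_covecE c p i : atlas c -> chart_dom c p ->
  coord_covec c p i = change_mx (chart_at p) c p *m delta_mx i ord0.
Proof.
move=> ac cp; apply/matrixP => j k.
by rewrite ord1 -colE mxE (to_chartE _ ac cp) -rowE !mxE.
Qed.

Lemma tangent_deriv_chart c (f : M -> R) p w : atlas c -> chart_dom c p ->
  differentiable (f \o chart_inv c) (chart_map c p) ->
  is_derive (chart_map (chart_at p) p) w (f \o chart_inv (chart_at p))
    ('D_(to_chart c p w) (f \o chart_inv c) (chart_map c p)).
Proof.
move=> ac cp df; have ap := chart_at_atlas p; have dp := chart_at_dom p.
set g := (fun x => chart_map c (chart_inv (chart_at p) x)).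
have dg : differentiable g (chart_map (chart_at p) p).
  exact: transition_differentiable.
have gE : g (chart_map (chart_at p) p) = chart_map c p by rewrite /g chart_mapK.
have dgw := is_derive_diff w dg.
rewrite -gE in df *.
apply: near_eq_is_derive (is_derive_chain dgw df).
apply: filterS (open_nbhs_nbhs (conj (@overlap_open (chart_at p) c) (overlap_map dp cp))).
by move=> x [cx dx]; rewrite /g /= chart_mapK.
Qed.

Lemma tangent_derivE c (f : M -> R) p w : atlas c -> chart_dom c p ->
  differentiable (f \o chart_inv c) (chart_map c p) ->
  tangent_deriv f p w = 'D_(to_chart c p w) (f \o chart_inv c) (chart_map c p).
Proof. by move=> ac cp df; have [_] := tangent_deriv_chart w ac cp df. Qed.

End ChartCalculus.

(** * Smooth functions and vector fields on M, cut-off and extension of germs *)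

Section Extension.
Variables (R : realType) (n : nat) (M : manifold R n).
Implicit Types (c d e : chart R n M) (p : M) (O : set M).

(** Smoothness in any other chart follows by composing with the smooth transition map, so one chart
    whose domain contains O is enough. *)
Lemma smooth_fun_chart c O (f : M -> R) : atlas c -> open O ->
  O `<=` chart_dom c -> smooth_on (chart_set c O) (f \o chart_inv c) ->
  smooth_fun O f.
Proof.
move=> ac oO Oc sf d ad.
have oO' e : open (chart_set e O) by exact: open_chart_set.
apply: (smooth_ext (f := (f \o chart_inv c) \o (fun x => chart_map c (chart_inv d x)))).
- exact: oO'.
- by move=> x [dx Ox] /=; rewrite chart_mapK//; exact: Oc.
- apply: (smooth_comp (U' := chart_set c O) (coordinates_rV R n)) => //.
  + move=> x [dx Ox]; split; first by apply: chart_map_cod; exact: Oc.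
    by rewrite chart_mapK//; exact: Oc.
  + move=> j; have oW := @overlap_open _ _ _ d c.
    have := (smooth_mxP _ oW).1 (smooth_transition ad ac) ord0 j.
    by apply: smooth_mono => x [dx Ox]; split=> //; exact: Oc.
Qed.

Lemma smooth_fun_local O (f : M -> R) :
  (forall p, O p -> exists O', [/\ open O', O' p & smooth_fun O' f]) ->
  smooth_fun O f.
Proof.
move=> loc c ac; apply: smooth_local => x [cx] /loc [U [oU Ux sf]].
by exists (chart_set c U); [|exact: sf].
Qed.

Lemma smooth_vfieldP O (X : M -> 'rV[R]_n) : open O ->
  smooth_vfield O X <-> forall c, atlas c -> forall j,
    smooth_on (chart_set c O)
      (fun x => to_chart c (chart_inv c x) (X (chart_inv c x)) ord0 j).
Proof.
move=> oO; split=> [sX c ac j|sX c ac].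
  by apply: (smooth_mxP _ _).1 (sX c ac) ord0 j; exact: open_chart_set.
apply/smooth_mxP; first exact: open_chart_set.
by move=> i j; rewrite ord1; exact: sX.
Qed.

Lemma smooth_fun_mono O O' (f : M -> R) :
  O `<=` O' -> smooth_fun O' f -> smooth_fun O f.
Proof.
by move=> OO' sf c ac; apply: smooth_mono (sf c ac) => x [cx /OO'].
Qed.

Lemma smooth_vfield_mono O O' (X : M -> 'rV[R]_n) :
  O `<=` O' -> smooth_vfield O' X -> smooth_vfield O X.
Proof.
by move=> OO' sf c ac; apply: smooth_mono (sf c ac) => x [cx /OO'].
Qed.

(** A bump of the model space is carried to M by a chart and extended by 0. The extension is smooth
    because the image of its compact support is closed in M; this is where the Hausdorff property
    enters. *)
Lemma bump p O : open O -> O p ->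
  exists b : M -> R, [/\ smooth_fun setT b, (\forall q \near p, b q = 1) &
    exists K, [/\ closed K, K `<=` O & forall q, ~ K q -> b q = 0]].
Proof.
move=> oO Op; set c := chart_at p.
have ac : atlas c by exact: chart_at_atlas.
have cp : chart_dom c p by exact: chart_at_dom.
have oU : open (chart_set c O) by exact: open_chart_set.
have Up : chart_set c O (chart_map c p).
  by split; [exact: chart_map_cod|rewrite chart_mapK].
have [b0 [sb0 b01 [K0 [cK0 K0U b00]]]] := bump_rV oU Up.
pose b q := if pselect (chart_dom c q) then b0 (chart_map c q) else 0.
pose K := chart_inv c @` K0.
have bE q : chart_dom c q -> b q = b0 (chart_map c q).
  by rewrite /b => cq; case: pselect.
have cK : closed K.
  apply: (compact_closed (@space_hausdorff _ _ M)).
  apply: continuous_compact cK0; apply: continuous_subspaceW (@chart_inv_continuous _ _ _ c).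
  by move=> x /K0U[].
have bK q : ~ K q -> b q = 0.
  move=> nK; rewrite /b; case: pselect => // cq; apply: b00 => K0q.
  by apply: nK; exists (chart_map c q) => //; exact: chart_mapK.
exists b; split.
- apply: smooth_fun_local => q _; have [cq|ncq] := pselect (chart_dom c q).
    exists (chart_dom c); split=> //; first exact: chart_dom_open.
    apply: (@smooth_fun_chart c) => //; first exact: chart_dom_open.
    apply: (smooth_ext (f := b0)); first exact: overlap_open.
      by move=> x [cx dx] /=; rewrite bE// chart_invK.
    exact: smooth_mono sb0.
  (* A point outside the chart domain lies in the open complement of K, where b is identically 0. *)
  exists (~` K); split; first exact: closed_openC.
    by move=> [x /K0U[cx _] xq]; apply: ncq; rewrite -xq; exact: chart_inv_dom.
  move=> d ad; apply: (smooth_ext (f := cst 0)); last exact: smooth_cst.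
    by apply: open_chart_set; exact: closed_openC.
  by move=> x [dx Kx] /=; rewrite bK.
- by apply: filterS (near_point cp b01) => q [cq b1]; rewrite bE.
- by exists K; split=> // q [x /K0U[_ Ox] <-].
Qed.

Lemma to_chartZ c p a w : atlas c -> chart_dom c p ->
  to_chart c p (a *: w) = a *: to_chart c p w :> 'rV[R]_n.
Proof. by move=> ac cp; rewrite !(to_chartE _ ac cp) scalemxAl. Qed.

Lemma to_chartD c p w w' : atlas c -> chart_dom c p ->
  to_chart c p (w + w') = to_chart c p w + to_chart c p w' :> 'rV[R]_n.
Proof. by move=> ac cp; rewrite !(to_chartE _ ac cp) mulmxDl. Qed.

Lemma to_chart0 c p : to_chart c p 0 = 0 :> 'rV[R]_n.
Proof. exact: derive0. Qed.

Lemma smooth_vfield0 O : smooth_vfield O (fun _ : M => 0).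
Proof.
move=> c ac; rewrite (_ : (fun x => _) = cst 0); first exact: smooth_cst.
by apply/funext => x; exact: to_chart0.
Qed.

Lemma smooth_vfieldD O X Y : open O -> smooth_vfield O X -> smooth_vfield O Y ->
  smooth_vfield O (fun p : M => X p + Y p).
Proof.
move=> oO sX sY c ac; have oU := @open_chart_set _ _ _ c _ oO.
apply: smooth_ext (smoothD oU (sX c ac) (sY c ac)) => //.
move=> x [cx Ox]; rewrite to_chartD//; exact: chart_inv_dom.
Qed.

Lemma smooth_vfieldZ O f X : open O -> smooth_fun O f -> smooth_vfield O X ->
  smooth_vfield O (fun p : M => f p *: X p).
Proof.
move=> oO sf /(smooth_vfieldP _ oO) sX; apply/(smooth_vfieldP _ oO) => c ac j.
have oU := @open_chart_set _ _ _ c _ oO.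
apply: smooth_ext (smoothM oU (sf c ac) (sX c ac j)) => //.
by move=> x [cx Ox]; rewrite to_chartZ ?mxE//; exact: chart_inv_dom.
Qed.

Lemma smooth_fun_cst O a : smooth_fun O (fun _ : M => a).
Proof. by move=> c ac; exact: smooth_cst. Qed.

(** M is covered by the open sets O, where both factors are smooth, and the complement of K, where
    the product is 0. *)
Lemma smooth_vfield_cut O (b : M -> R) K (X : M -> 'rV[R]_n) :
  open O -> smooth_fun setT b -> closed K -> K `<=` O ->
  (forall q, ~ K q -> b q = 0) -> smooth_vfield O X ->
  smooth_vfield setT (fun q => b q *: X q).
Proof.
move=> oO sb cK KO bK sX c ac; apply: smooth_local => x [cx _].
have [Ox|nOx] := pselect (O (chart_inv c x)).
  exists (chart_set c O) => //.
  by apply: smooth_vfieldZ => //; exact: smooth_fun_mono sb.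
exists (chart_set c (~` K)); first by split=> // /KO.
apply: (smooth_ext (f := cst 0)); last exact: smooth_cst.
  by apply: open_chart_set; exact: closed_openC.
by move=> y [cy Ky]; rewrite bK// scale0r to_chart0.
Qed.

Lemma smooth_fun_cut O (b : M -> R) K (f : M -> R) :
  open O -> smooth_fun setT b -> closed K -> K `<=` O ->
  (forall q, ~ K q -> b q = 0) -> smooth_fun O f ->
  smooth_fun setT (fun q => b q * f q).
Proof.
move=> oO sb cK KO bK sf c ac; apply: smooth_local => x [cx _].
have [Ox|nOx] := pselect (O (chart_inv c x)).
  exists (chart_set c O) => //.
  apply: smoothM; first exact: open_chart_set.
    exact: (smooth_fun_mono _ sb).
  exact: sf.
exists (chart_set c (~` K)); first by split=> // /KO.
apply: (smooth_ext (f := cst 0)); last exact: smooth_cst.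
  by apply: open_chart_set; exact: closed_openC.
by move=> y [cy Ky] /=; rewrite bK// mul0r.
Qed.

Lemma smooth_vfield_extend O p (X : M -> 'rV[R]_n) :
  open O -> O p -> smooth_vfield O X ->
  exists2 W, smooth_vfield setT W & \forall q \near p, W q = X q.
Proof.
move=> oO Op sX; have [b [sb b1 [K [cK KO bK]]]] := bump oO Op.
exists (fun q => b q *: X q); first exact: smooth_vfield_cut bK sX.
by apply: filterS b1 => q ->; rewrite scale1r.
Qed.

Lemma smooth_fun_extend O p (f : M -> R) :
  open O -> O p -> smooth_fun O f ->
  exists2 g, smooth_fun setT g & \forall q \near p, g q = f q.
Proof.
move=> oO Op sf; have [b [sb b1 [K [cK KO bK]]]] := bump oO Op.
exists (fun q => b q * f q); first exact: smooth_fun_cut bK sf.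
by apply: filterS b1 => q ->; rewrite mul1r.
Qed.

Lemma smooth_change_mx_fun c d i j : atlas c -> atlas d ->
  smooth_fun (chart_dom c `&` chart_dom d) (fun p : M => change_mx c d p i j).
Proof.
move=> ac ad; apply: (@smooth_fun_chart c) => //.
- by apply: openI; exact: chart_dom_open.
- by apply: smooth_mono (smooth_change_mx ac ad i j) => x [cx [_ dx]].
Qed.

Lemma smooth_const_vfield c (y : 'rV[R]_n) : atlas c ->
  smooth_vfield (chart_dom c) (fun q : M => of_chart c q y).
Proof.
move=> ac; apply/smooth_vfieldP; first exact: chart_dom_open.
move=> d ad j; have oW := @overlap_open _ _ _ d c.
apply: (smooth_ext (f := fun x => \sum_k y ord0 k * change_mx c d (chart_inv d x) k j)).
- exact: oW.
- move=> x [dx cx]; rewrite (of_chartK _ ac ad cx (chart_inv_dom dx)).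
  by rewrite mxE.
- apply: smooth_sum => // k _; apply: smoothM => //; first exact: smooth_cst.
  apply: smooth_mono (smooth_change_mx_fun k j ac ad ad).
  by move=> x [dx cx]; split=> //; split=> //; exact: chart_inv_dom.
Qed.

Lemma smooth_vfield_component c O (X : M -> 'rV[R]_n) j : atlas c -> open O ->
  smooth_vfield O X ->
  smooth_fun (chart_dom c `&` O) (fun q => to_chart c q (X q) ord0 j).
Proof.
move=> ac oO /(smooth_vfieldP _ oO) sX; apply: (@smooth_fun_chart c) => //.
- by apply: openI => //; exact: chart_dom_open.
- by apply: smooth_mono (sX c ac j) => x [cx [_ Ox]].
Qed.

Lemma smooth_chart_map c j : atlas c ->
  smooth_fun (chart_dom c) (fun q : M => chart_map c q ord0 j).
Proof.
move=> ac; apply: (@smooth_fun_chart c) => //; first exact: chart_dom_open.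
have oW := @overlap_open _ _ _ c c.
apply: (smooth_ext (f := fun x : 'rV[R]_n => x ord0 j)) => //.
  by move=> x [cx _] /=; rewrite chart_invK.
exact: (smooth_coord _ j (coordinates_rV R n)).
Qed.

Lemma smooth_fun_differentiable c O (f : M -> R) p : atlas c -> open O -> O p ->
  chart_dom c p -> smooth_fun O f ->
  differentiable (f \o chart_inv c) (chart_map c p).
Proof.
move=> ac oO Op cp sf.
apply: (smooth_differentiable (U := chart_set c O) (coordinates_rV R n)).
- exact: open_chart_set.
- exact: sf.
- by split; [exact: chart_map_cod|rewrite chart_mapK].
Qed.

Lemma smooth_vfield_differentiable c O (X : M -> 'rV[R]_n) p : atlas c ->
  open O -> O p -> chart_dom c p -> smooth_vfield O X ->
  differentiable (fun x => to_chart c (chart_inv c x) (X (chart_inv c x)))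
    (chart_map c p).
Proof.
move=> ac oO Op cp sX.
apply: (smooth_differentiable_mx (U := chart_set c O) (coordinates_rV R n)).
- exact: open_chart_set.
- exact: sX.
- by split; [exact: chart_map_cod|rewrite chart_mapK].
Qed.

End Extension.

(** * Connection coefficients of an anisotropic derivation *)

Section Derivation.
Variables (R : realType) (n : nat) (M : manifold R n) (A : set (tangent M)).
Hypothesis A_open : tangent_open A.
Implicit Types (c d : chart R n M) (p : M) (v : A).

Definition lift_chart c (u : tangent M) : 'rV[R]_n * 'rV[R]_n :=
  (chart_map c (base u), to_chart c (base u) (vec u)).

Lemma lift_chartK c (u : tangent M) : atlas c -> chart_dom c (base u) ->
  tangent_lift c (lift_chart c u) = u.
Proof.
case: u => p w ac cp; rewrite /tangent_lift /lift_chart /= chart_mapK//.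
by rewrite (to_chartK _ ac cp).
Qed.

Lemma lift_chart_in c v : atlas c -> chart_dom c (foot v) ->
  tangent_chart_set c A (lift_chart c (val v)).
Proof.
move=> ac cp; split; first exact: chart_map_cod.
by rewrite lift_chartK//; have := valP v; rewrite inE.
Qed.

Lemma ext0E (h : A -> R) v : ext0 h (val v) = h v.
Proof. by rewrite /ext0 valK. Qed.

Lemma tangent_chart_setP c z : tangent_chart_set c A z ->
  exists2 v : A, val v = tangent_lift c z & chart_dom c (foot v).
Proof.
move=> [cz Az]; have Az' : tangent_lift c z \in A by rewrite inE.
by exists (Sub (tangent_lift c z) Az'); rewrite ?/foot SubK//=; exact: chart_inv_dom.
Qed.

Lemma tangent_liftK c z : atlas c -> chart_cod c z.1 ->
  lift_chart c (tangent_lift c z) = z.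
Proof.
case: z => x y ac cx; rewrite /lift_chart /= (chart_invK cx).
have cp := chart_inv_dom cx.
by rewrite (of_chartK _ ac ac cp cp) (change_mx_id ac cp) mulmx1.
Qed.

Section Localization.
Variables (delta : A -> (M -> 'rV[R]_n) -> 'rV[R]_n) (Z : M -> 'rV[R]_n).
Hypothesis hdelta : anisotropic_derivation delta Z.

Lemma delta0 v : delta v (fun _ => 0) = 0.
Proof.
have := ader_add hdelta v (@smooth_vfield0 _ _ M setT) (@smooth_vfield0 _ _ M setT).
have -> : (fun p : M => 0 + 0 : 'rV[R]_n) = (fun _ => 0).
  by apply/funext => p; rewrite addr0.
by move=> h; apply: (@addrI _ (delta v (fun _ => 0))); rewrite -h addr0.
Qed.

(** Let W = X - Y and let b be a bump supported where W vanishes, with b = 1 near the foot point p.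
    Then b W = 0 everywhere, and the Leibniz rule at p reads 0 = Z(b) W(p) + b(p) delta^v W =
    delta^v W. *)
Lemma delta_local_eq v X Y : smooth_vfield setT X -> smooth_vfield setT Y ->
  (\forall q \near foot v, X q = Y q) -> delta v X = delta v Y.
Proof.
move=> sX sY /near_openP [ O [oO Ov XY] ].
have [b [sb b1 [K [cK KO bK]]]] := bump oO Ov.
pose W q := X q + (-1) *: Y q.
have sY1 : smooth_vfield setT (fun q => (-1) *: Y q).
  by apply: smooth_vfieldZ => //; [exact: openT|exact: smooth_fun_cst].
have sW : smooth_vfield setT W by apply: smooth_vfieldD => //; exact: openT.
have XE : X = fun q => Y q + W q.
  by apply/funext => q; rewrite /W scaleN1r addrC subrK.
rewrite [in LHS]XE (ader_add hdelta)//.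
suff -> : delta v W = 0 by rewrite addr0.
have := ader_leibniz hdelta v sb sW.
have -> : (fun q => b q *: W q) = (fun _ => 0).
  apply/funext => q; have [Kq|nKq] := pselect (K q).
    by rewrite /W (XY _ (KO _ Kq)) scaleN1r subrr scaler0.
  by rewrite bK// scale0r.
rewrite delta0 (nbhs_singleton b1) scale1r /W (XY _ Ov) scaleN1r subrr scaler0.
by rewrite add0r.
Qed.

Lemma delta_sum v I (r : seq I) (X : I -> M -> 'rV[R]_n) :
  (forall i, smooth_vfield setT (X i)) ->
  smooth_vfield setT (fun q => \sum_(i <- r) X i q) /\
  delta v (fun q => \sum_(i <- r) X i q) = \sum_(i <- r) delta v (X i).
Proof.
move=> sX; elim: r => [|i r [s E]].
  rewrite big_nil; have -> : (fun q : M => \sum_(i <- [::]) X i q) = (fun _ => 0).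
    by apply/funext => q; rewrite big_nil.
  by split; [exact: smooth_vfield0|exact: delta0].
rewrite big_cons -E.
have -> : (fun q : M => \sum_(j <- i :: r) X j q) =
    (fun q => X i q + \sum_(j <- r) X j q).
  by apply/funext => q; rewrite big_cons.
split; last exact: (ader_add hdelta v (sX i) s).
exact: (smooth_vfieldD openT (sX i) s).
Qed.

(** A global field with the germ at p of the i-th coordinate field of c, since [delta] takes global
    fields as arguments. The choice is arbitrary; by [delta_local_eq] it does not affect [delta]
    over p. *)
Definition frame c p i : M -> 'rV[R]_n :=
  xget (fun _ => 0) [set W | smooth_vfield setT W /\
                       \forall q \near p, W q = coord_vec c q i].

Lemma frameP c p i : atlas c -> chart_dom c p ->
  smooth_vfield setT (frame c p i) /\
  \forall q \near p, frame c p i q = coord_vec c q i.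
Proof.
move=> ac cp; have oc := @chart_dom_open _ _ _ c.
have [W sW We] := smooth_vfield_extend oc cp
  (smooth_const_vfield (delta_mx ord0 i) ac).
by apply: (@xgetPex _ (fun _ => 0) [set W | smooth_vfield setT W /\ 
  \forall q \near p, W q = coord_vec c q i]); exists W.
Qed.

(* Connection coefficients of delta in the chart c: the i-th row holds the
   components of delta^v (d/dx^i). *)
Definition christoffel c v : 'M[R]_n :=
  \matrix_i to_chart c (foot v) (delta v (frame c (foot v) i)).

(** The coordinate formula of a connection. Near the foot point W is the combination of the
    coordinate fields with its components as coefficients; locality, additivity and the Leibniz rule
    then compute [delta] on it. *)
Lemma delta_chart c v W : atlas c -> chart_dom c (foot v) ->
  smooth_vfield setT W ->
  to_chart c (foot v) (delta v W) =
  'D_(to_chart c (foot v) (Z (foot v)))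
     (fun x => to_chart c (chart_inv c x) (W (chart_inv c x)))
     (chart_map c (foot v))
  + to_chart c (foot v) (W (foot v)) *m christoffel c v.
Proof.
move=> ac cp sW; set p := foot v in cp *.
have oc := @chart_dom_open _ _ _ c.
(* The components of W live only on the chart domain, while the Leibniz rule is available for global
   functions; they are replaced by global functions with the same germs. *)
have /choice [f fP] : forall j, exists f : M -> R, smooth_fun setT f /\
    \forall q \near p, f q = to_chart c q (W q) ord0 j.
  move=> j; have := smooth_vfield_component j ac openT sW.
  rewrite setIT => sWj.
  by have [g sg gE] := smooth_fun_extend oc cp sWj; exists g.
pose W' q := \sum_j f j q *: frame c p j q.
have sfr j : smooth_vfield setT (fun q => f j q *: frame c p j q).
  by apply: smooth_vfieldZ; [exact: openT|case: (fP j)|case: (frameP j ac cp)].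
have [sW' W'E] := delta_sum v (index_enum 'I_n) sfr.
have WW' : \forall q \near p, W q = W' q.
  have h1 : \forall q \near p, forall j, f j q = to_chart c q (W q) ord0 j.
    by apply: filter_forall => j; case: (fP j).
  have h2 : \forall q \near p, forall j, frame c p j q = coord_vec c q j.
    by apply: filter_forall => j; case: (frameP j ac cp).
  have h3 : \forall q \near p, chart_dom c q by exact: open_nbhs_nbhs.
  near=> q.
  have e1 : forall j, f j q = to_chart c q (W q) ord0 j by near: q.
  have e2 : forall j, frame c p j q = coord_vec c q j by near: q.
  have cq : chart_dom c q by near: q.
  rewrite /W' -[LHS](to_chartK _ ac cq) (of_chartE _ ac cq) mulmx_sum_row.
  by apply: eq_bigr => j _; rewrite e1 e2 (coord_vecE _ ac cq) rowE.
rewrite (delta_local_eq sW sW' WW') W'E (to_chartE _ ac cp) mulmx_suml.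
rewrite [in RHS]mulmx_sum_row [X in X + _]row_sum_delta -big_split /=.
apply: eq_bigr => j _; have [sfj fj] := fP j; have [sF Fj] := frameP j ac cp.
rewrite (ader_leibniz hdelta)// -/p mulmxDl -!scalemxAl rowK.
rewrite -!(to_chartE _ ac cp) -/p (nbhs_singleton fj) (nbhs_singleton Fj).
congr (_ + _).
rewrite (of_chartK _ ac ac cp cp) (change_mx_id ac cp) mulmx1; congr (_ *: _).
have dW := smooth_vfield_differentiable ac openT I cp sW.
have df := smooth_fun_differentiable ac openT I cp sfj.
rewrite (tangent_derivE _ ac cp df) (derive_entry _ _ _ dW).
apply: near_eq_derive; apply: filterS (near_chart cp fj) => x [cx].
exact.
Unshelve. all: by end_near. Qed.

Lemma delta_component c j W : atlas c -> smooth_vfield setT W ->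
  smooth_afun_in c (fun v => to_chart c (foot v) (delta v W) ord0 j).
Proof.
move=> ac sW; have [_ /(_ c ac (fun _ => j) (fun _ => j))] := ader_smooth hdelta sW.
apply: smooth_ext; first exact: A_open.
move=> z Uz /=; have [v vE cv] := tangent_chart_setP Uz.
rewrite -vE !ext0E /vector_tensor /pairing (coord_covecE _ ac cv) mulmxA.
by rewrite -(to_chartE _ ac cv) -colE mxE.
Qed.

(** The fields in [christoffel] change with the foot point. Near a given point one fixed frame field
    has the required germ at every neighbouring foot point, so by [delta_local_eq] it may replace
    all the others, and [ader_smooth] applies to it. *)
Lemma smooth_christoffel c i j : atlas c ->
  smooth_on (tangent_chart_set c A)
    (ext0 (fun v => christoffel c v i j) \o tangent_lift c).
Proof.
move=> ac; apply: smooth_local => z Uz.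
have [v vE cv] := tangent_chart_setP Uz.
have [sF /near_openP [ O [oO Ov FO] ] ] := frameP i ac cv.
pose U' := tangent_chart_set c A `&` [set z | chart_set c O z.1].
have oU' : open U'.
  apply: openI; first exact: A_open.
  apply: open_comp; first by move=> *; exact: cvg_fst.
  exact: open_chart_set.
have vz : foot v = chart_inv c z.1 by rewrite /foot vE.
exists U'; first by split=> //; split; [case: Uz|rewrite -vz].
apply: (smooth_ext (f := ext0 (fun v' =>
  to_chart c (foot v') (delta v' (frame c (foot v) i)) ord0 j) \o tangent_lift c)).
- exact: oU'.
- move=> z' [Uz' [_ Oz']] /=; have [v' v'E cv'] := tangent_chart_setP Uz'.
  have v'z : foot v' = chart_inv c z'.1 by rewrite /foot v'E.
  rewrite -v'E !ext0E mxE.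
  have [sF' Fe] := frameP i ac cv'.
  rewrite (@delta_local_eq v' _ (frame c (foot v') i))//.
  have : \forall q \near foot v', O q.
    by apply: open_nbhs_nbhs; split=> //; rewrite v'z.
  by move=> h; near=> q; rewrite FO ?(near Fe q)//; exact: (near h q).
- apply: smooth_mono (delta_component j ac sF).
  by move=> ? [].
Unshelve. all: by end_near. Qed.

(** Apply [delta_chart] in the chart d to the coordinate fields of c, whose components in d are the
    rows of the Jacobian. Differentiating the Jacobian along Z produces the inhomogeneous term. *)
Lemma christoffel_change c d v : atlas c -> atlas d ->
  chart_dom c (foot v) -> chart_dom d (foot v) ->
  christoffel c v *m change_mx c d (foot v) =
  'D_(to_chart d (foot v) (Z (foot v)))
     (fun x => change_mx c d (chart_inv d x)) (chart_map d (foot v))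
  + change_mx c d (foot v) *m christoffel d v.
Proof.
move=> ac ad cp dp; set p := foot v in cp dp *.
have dC : differentiable (fun x => change_mx c d (chart_inv d x)) (chart_map d p).
  apply: differentiable_mx => i j.
  have oI := openI (@chart_dom_open _ _ _ c) (@chart_dom_open _ _ _ d).
  exact: (smooth_fun_differentiable (f := fun q => change_mx c d q i j)
            ad oI (conj cp dp) dp (smooth_change_mx_fun i j ac ad)).
apply/row_matrixP => i; rewrite row_mul rowK linearD /= row_mul.
have [sF Fe] := frameP i ac cp.
have -> : to_chart c (foot v) (delta v (frame c (foot v) i)) *m change_mx c d p
  = to_chart d p (delta v (frame c p i)).
  by rewrite -(of_chartK _ ac ad cp dp) (to_chartK _ ac cp).
rewrite (delta_chart ad dp sF) -/p (nbhs_singleton Fe) (of_chartK _ ac ad cp dp).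
rewrite -rowE; congr (_ + _).
have dF := smooth_vfield_differentiable ad openT I dp sF.
apply/rowP => j; rewrite (derive_entry _ _ _ dF) [in RHS]mxE (derive_entry _ _ _ dC).
have cd : \forall x \near chart_map d p, chart_dom c (chart_inv d x).
  by apply: filterS (open_nbhs_nbhs (conj (@overlap_open _ _ _ d c) (overlap_map dp cp))) => x [].
apply: near_eq_derive; apply: filterS2 (near_chart dp Fe) cd => x [dx ->] cx.
by rewrite (of_chartK _ ac ad cx (chart_inv_dom dx)) -rowE mxE.
Qed.

End Localization.
End Derivation.

(** * Multilinear functions and their components *)

Section Slots.

Lemma insert_at_same (E : Type) m (k : 'I_m.+1) (x : E) f : insert_at k x f k = x.
Proof. by rewrite /insert_at unlift_none. Qed.

Lemma insert_at_lift (E : Type) m (k : 'I_m.+1) (x : E) f i :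
  insert_at k x f (lift k i) = f i.
Proof. by rewrite /insert_at liftK. Qed.

Lemma insert_at_ext (E : Type) m (k : 'I_m.+1) (x : E) f g :
  g k = x -> (forall i, g (lift k i) = f i) -> insert_at k x f = g.
Proof.
move=> gk gl; apply/funext => i; have [j ->|->] := unliftP k i.
  by rewrite insert_at_lift gl.
by rewrite insert_at_same gk.
Qed.

Lemma insert_at_map (E F : Type) (h : E -> F) m (k : 'I_m.+1) (x : E) f :
  (fun i => h (insert_at k x f i)) = insert_at k (h x) (fun i => h (f i)).
Proof.
apply/esym/insert_at_ext; first by rewrite insert_at_same.
by move=> i; rewrite insert_at_lift.
Qed.

(** Passes from an inserted slot, as in contractions, to an updated slot, as in [multilinear]; y is
    a placeholder to be overwritten. *)
Lemma with_insert_at (E : Type) m (k : 'I_m.+1) (x y : E) f :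
  insert_at k x f = [eta insert_at k y f with k |-> x].
Proof.
apply: insert_at_ext => /=; first by rewrite eqxx.
by move=> i; rewrite eq_sym (negPf (neq_lift _ _)) insert_at_lift.
Qed.

Lemma insert_at_with (E : Type) m (k : 'I_m.+1) (x y : E) f i :
  insert_at k x [eta f with i |-> y] = [eta insert_at k x f with lift k i |-> y].
Proof.
apply: insert_at_ext => /=; first by rewrite (negPf (neq_lift _ _)) insert_at_same.
by move=> j; rewrite (inj_eq lift_inj) insert_at_lift.
Qed.

Lemma insert_at_head (E : Type) m (f : 'I_m.+1 -> E) :
  insert_at ord0 (f ord0) (fun i => f (lift ord0 i)) = f.
Proof. exact: insert_at_ext. Qed.

Lemma with_lshift (E : Type) r1 r2 (th : 'I_(r1 + r2) -> E) (k : 'I_r1) x :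
  [eta th with lshift r2 k |-> x] \o lshift r2 = [eta th \o lshift r2 with k |-> x].
Proof.
by apply/funext => i /=; rewrite (inj_eq (@lshift_inj _ _)).
Qed.

Lemma with_rshift (E : Type) r1 r2 (th : 'I_(r1 + r2) -> E) (k : 'I_r2) x :
  [eta th with rshift r1 k |-> x] \o @rshift r1 r2 =
  [eta th \o @rshift r1 r2 with k |-> x].
Proof.
by apply/funext => i /=; rewrite (inj_eq (@rshift_inj _ _)).
Qed.

Lemma with_lrshift (E : Type) r1 r2 (th : 'I_(r1 + r2) -> E) (k : 'I_r1) x :
  [eta th with lshift r2 k |-> x] \o @rshift r1 r2 = th \o @rshift r1 r2.
Proof. by apply/funext => i /=; rewrite eq_rlshift. Qed.

Lemma with_rlshift (E : Type) r1 r2 (th : 'I_(r1 + r2) -> E) (k : 'I_r2) x :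
  [eta th with rshift r1 k |-> x] \o lshift r2 = th \o lshift r2.
Proof. by apply/funext => i /=; rewrite eq_lrshift. Qed.

End Slots.

Section Multilinear.
Variable R : realType.

Lemma scalar_linear_sum (E : lmodType R) (f : E -> R) N (a : 'I_N -> R) (e : 'I_N -> E) :
  (forall t x y, f (t *: x + y) = t * f x + f y) ->
  f (\sum_i a i *: e i) = \sum_i a i * f (e i).
Proof.
move=> fl; have f0 : f 0 = 0.
  have := fl 1 0 0; rewrite scale1r addr0 mul1r => h.
  by apply: (@addrI _ (f 0)); rewrite -h addr0.
by elim/big_rec2 : _ => [//|i y x _ <-]; exact: fl.
Qed.

Lemma eta_with (T : eqType) (U : Type) (f : T -> U) k x :
  [eta f with k |-> x] = (fun i => if i == k then x else f i) :> (T -> U).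
Proof. by []. Qed.

Section Expansion.
Variables (E : lmodType R) (s N : nat) (F : ('I_s -> E) -> R) (e : 'I_N -> E).
Hypothesis Flin : forall th (k : 'I_s) (t : R) (a b : E),
  F [eta th with k |-> t *: a + b] =
  t * F [eta th with k |-> a] + F [eta th with k |-> b].

Lemma multilinear_sum th k (a : 'I_N -> R) :
  F [eta th with k |-> \sum_i a i *: e i] =
  \sum_i a i * F [eta th with k |-> e i].
Proof.
apply: (scalar_linear_sum (f := fun x => F [eta th with k |-> x])) => *.
exact: Flin.
Qed.

Lemma multilinear_expand (a : 'I_s -> 'I_N -> R) :
  F (fun k => \sum_i a k i *: e i) =
  \sum_(I : {ffun 'I_s -> 'I_N}) (\prod_k a k (I k)) * F (fun k => e (I k)).
Proof.
(* Induction on the number m of leading slots still to be expanded; in the slots from m on the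
   coefficients are already those of a single basis vector. *)
suff main m : forall a : 'I_s -> 'I_N -> R,
  (forall k : 'I_s, (m <= k)%N -> exists j, a k = fun i => (i == j)%:R) ->
  F (fun k => \sum_i a k i *: e i) =
  \sum_(I : {ffun 'I_s -> 'I_N}) (\prod_k a k (I k)) * F (fun k => e (I k)).
  by apply: (main s) => k; rewrite leqNgt ltn_ord.
elim: m => [|m ih] {}a ha.
  have /choice [j jE] : forall k, exists j, a k = fun i => (i == j)%:R.
    by move=> k; exact: ha.
  (* When every slot holds a basis vector, just one multi-index has a nonzero coefficient. *)
  rewrite (bigD1 [ffun k => j k])//= [X in _ + X]big1 ?addr0.
    rewrite big1 ?mul1r; last by move=> k _; rewrite jE ffunE eqxx.
    congr F; apply/funext => k; rewrite ffunE (bigD1 (j k))//= jE eqxx scale1r.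
    by rewrite big1 ?addr0// => i /negPf ->; rewrite scale0r.
  move=> I IJ; have [k kI] : exists k, I k != j k.
    apply/existsP; apply: contraNT IJ => /existsPn h; apply/eqP/ffunP => k.
    by rewrite ffunE; apply/eqP; have := h k; rewrite negbK.
  by rewrite (bigD1 k)//= jE (negPf kI) !mul0r.
have [ms|ms] := ltnP m s; last first.
  by apply: ih => k mk; have := ltn_ord k; rewrite ltnNge (leq_trans ms mk).
pose k0 := Ordinal ms.
(* The coefficients after slot m has been filled with the j-th basis vector. *)
pose a' j k i := if k == k0 then (i == j)%:R else a k i.
have step j : F [eta (fun k => \sum_i a k i *: e i) with k0 |-> e j] =
  \sum_(I : {ffun 'I_s -> 'I_N}) (\prod_k a' j k (I k)) * F (fun k => e (I k)).
  rewrite -ih; last first.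
    move=> k mk; rewrite /a'; case: (eqVneq k k0) => [_|kk0]; first by exists j.
    apply: ha; rewrite ltn_neqAle mk andbT; apply: contraNN kk0 => /eqP km.
    exact/eqP/val_inj.
  congr F; apply/funext => k; rewrite eta_with /a'; case: eqP => // _.
  rewrite (bigD1 j)//= eqxx scale1r big1 ?addr0// => i /negPf ->.
  by rewrite scale0r.
have -> : (fun k => \sum_i a k i *: e i) =
  [eta (fun k => \sum_i a k i *: e i) with k0 |-> \sum_i a k0 i *: e i].
  by apply/funext => k; rewrite eta_with; case: eqP => [->|].
rewrite multilinear_sum; under eq_bigr do rewrite step big_distrr /=.
rewrite exchange_big /=; apply: eq_bigr => I _.
under eq_bigr do rewrite mulrA; rewrite -mulr_suml; congr (_ * _).
rewrite (bigD1 (I k0))//= [X in _ + X]big1 ?addr0.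
  rewrite (bigD1 k0)//= [in RHS](bigD1 k0)//= {1}/a' eqxx eqxx mul1r.
  by congr (_ * _); apply: eq_bigr => k /negPf kk0; rewrite /a' kk0.
by move=> j jI; rewrite (bigD1 k0)//= {1}/a' eqxx eq_sym (negPf jI) mul0r mulr0.
Qed.
End Expansion.

(** The derivative of a finite product of factors f with derivatives d. The recursive form applies
    the two-factor product rule once per entry of the list. *)
Fixpoint prod_deriv (I : Type) (r : seq I) (f d : I -> R) : R :=
  if r is i :: r' then d i * \prod_(j <- r') f j + f i * prod_deriv r' f d
  else 0.

Lemma is_derive_prodr (V : normedModType R) (I : Type) (r : seq I)
    (f : I -> V -> R) x v (d : I -> R) :
  (forall i, is_derive x v (f i) (d i)) ->
  is_derive x v (fun y => \prod_(i <- r) f i y) (prod_deriv r (f^~ x) d).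
Proof.
move=> h; elim: r => [|i r ih] /=.
  have -> : (fun y => \prod_(i <- [::]) f i y) = cst (1 : R).
    by apply/funext => y; rewrite big_nil.
  exact: is_derive_cst.
have -> : (fun y => \prod_(j <- i :: r) f j y) =
    (fun y => f i y * \prod_(j <- r) f j y).
  by apply/funext => y; rewrite big_cons.
exact: is_derive_mul.
Qed.

Lemma smooth_prod_deriv (V : normedModType R) (U : set V) (I : Type) (r : seq I)
    (f d : I -> V -> R) : open U ->
  (forall i, smooth_on U (f i)) -> (forall i, smooth_on U (d i)) ->
  smooth_on U (fun y => prod_deriv r (f^~ y) (d^~ y)).
Proof.
move=> oU sf sd; elim: r => [|i r ih] /=; first exact: smooth_cst.
apply: smoothD => //; apply: smoothM => //.
by apply: smooth_prod => // j _; exact: sf.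
Qed.

End Multilinear.

(** * First-order jets of tensors in a chart *)

Section Jets.
Variables (R : realType) (n : nat) (M : manifold R n) (A : set (tangent M)).
Hypothesis A_open : tangent_open A.
Implicit Types (c d : chart R n M) (p : M) (v : A).

(* The tensor T at the point of TM with coordinates z, as a function of the
   components in the chart c of its arguments. *)
Definition local_rep r s (T : tensor A r s) c (th : 'I_r -> 'cV[R]_n)
    (X : 'I_s -> 'rV[R]_n) (z : 'rV[R]_n * 'rV[R]_n) : R :=
  ext0 (fun v => T v
    (fun k => change_mx (chart_at (foot v)) c (foot v) *m th k)
    (fun l => X l *m change_mx c (chart_at (foot v)) (foot v)))
  (tangent_lift c z).

Definition component r s (T : tensor A r s) c (I : 'I_r -> 'I_n)
    (J : 'I_s -> 'I_n) : 'rV[R]_n * 'rV[R]_n -> R :=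
  ext0 (fun v => T v (fun k => coord_covec c (foot v) (I k))
                     (fun l => coord_vec c (foot v) (J l))) \o tangent_lift c.

(** Separates the arguments from the point: T becomes a polynomial in the components of its
    arguments, with coefficients that are smooth in z. *)
Lemma local_repE r s (T : tensor A r s) c th X z : multilinear T -> atlas c ->
  tangent_chart_set c A z ->
  local_rep T c th X z =
  \sum_(I : {ffun 'I_r -> 'I_n}) \sum_(J : {ffun 'I_s -> 'I_n})
    (\prod_k th k (I k) ord0) * (\prod_l X l ord0 (J l)) * component T c I J z.
Proof.
move=> [Tth TX] ac Uz; have [v vE cv] := tangent_chart_setP Uz.
rewrite /local_rep /component /= -vE ext0E; under eq_bigr do under eq_bigr do rewrite ext0E.
have -> : (fun k => change_mx (chart_at (foot v)) c (foot v) *m th k) =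
    (fun k => \sum_i th k i ord0 *: coord_covec c (foot v) i).
  apply/funext => k; rewrite {1}[th k]matrix_sum_delta mulmx_sumr.
  apply: eq_bigr => i _; rewrite big_ord1 -scalemxAr.
  by rewrite (coord_covecE _ ac cv).
have -> : (fun l => X l *m change_mx c (chart_at (foot v)) (foot v)) =
    (fun l => \sum_i X l ord0 i *: coord_vec c (foot v) i).
  apply/funext => l; rewrite mulmx_sum_row; apply: eq_bigr => i _.
  by rewrite (coord_vecE _ ac cv) rowE.
rewrite (multilinear_expand (F := fun th => T v th _)); last by move=> *; exact: Tth.
apply: eq_bigr => I _.
rewrite (multilinear_expand (F := fun X => T v _ X)); last by move=> *; exact: TX.
by rewrite big_distrr /=; apply: eq_bigr => J _; rewrite mulrA.
Qed.

(** The expansion of [local_repE] differentiated by the product rule, where z0, th, X are the values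
    and dz, dth, dX the velocities of the point and of the arguments. *)
Definition jet r s (T : tensor A r s) c (z0 dz : 'rV[R]_n * 'rV[R]_n)
    (th dth : 'I_r -> 'cV[R]_n) (X dX : 'I_s -> 'rV[R]_n) : R :=
  \sum_(I : {ffun 'I_r -> 'I_n}) \sum_(J : {ffun 'I_s -> 'I_n})
    ((prod_deriv (index_enum 'I_r) (fun k => th k (I k) ord0)
        (fun k => dth k (I k) ord0) * (\prod_l X l ord0 (J l)) +
      (\prod_k th k (I k) ord0) *
        prod_deriv (index_enum 'I_s) (fun l => X l ord0 (J l))
          (fun l => dX l ord0 (J l))) * component T c I J z0 +
     (\prod_k th k (I k) ord0) * (\prod_l X l ord0 (J l)) *
       'D_dz (component T c I J) z0).

Definition coordinates_TM :=
  coordinates_prod (coordinates_rV R n) (coordinates_rV R n).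

Lemma component_differentiable r s (T : tensor A r s) c (I : 'I_r -> 'I_n)
    (J : 'I_s -> 'I_n) z :
  atensor T -> atlas c -> tangent_chart_set c A z ->
  differentiable (component T c I J) z.
Proof.
move=> [_ sT] ac Uz; apply: (smooth_differentiable coordinates_TM _ _ Uz).
  exact: A_open.
exact: sT.
Qed.

(* The derivative of T along a curve depends only on the first-order data of
   the curve. *)
Lemma is_derive_local_rep r s (T : tensor A r s) c
    (z : R -> 'rV[R]_n * 'rV[R]_n) dz (th : R -> 'I_r -> 'cV[R]_n) dth
    (X : R -> 'I_s -> 'rV[R]_n) dX :
  atensor T -> atlas c -> tangent_chart_set c A (z 0) ->
  is_derive (0 : R) (1 : R) z dz ->
  (forall k, is_derive (0 : R) (1 : R) (th^~ k) (dth k)) ->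
  (forall l, is_derive (0 : R) (1 : R) (X^~ l) (dX l)) ->
  is_derive (0 : R) (1 : R) (fun t => local_rep T c (th t) (X t) (z t))
    (jet T c (z 0) dz (th 0) dth (X 0) dX).
Proof.
move=> aT ac Uz hz hth hX; have [mT _] := aT.
have zc : z @ (0 : R) --> z 0.
  by have [h _] := hz; apply: differentiable_continuous; exact/derivable1_diffP.
have Uzt : \forall t \near (0 : R), tangent_chart_set c A (z t).
  by apply: zc; apply: open_nbhs_nbhs; split=> //; exact: A_open.
apply: (near_eq_is_derive (f := fun t =>
  \sum_(I : {ffun 'I_r -> 'I_n}) \sum_(J : {ffun 'I_s -> 'I_n})
    (\prod_k th t k (I k) ord0) * (\prod_l X t l ord0 (J l)) *
      component T c I J (z t))).
  by apply: filterS Uzt => t Ut; rewrite local_repE.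
apply: is_derive_sumr => I _; apply: is_derive_sumr => J _.
apply: is_derive_mul; last first.
  have dc := @component_differentiable _ _ T c I J _ aT ac Uz.
  exact: (is_derive_curve hz dc).
apply: is_derive_mul; apply: is_derive_prodr => i.
  by have /is_derive_mxP := hth i; apply.
by have /is_derive_mxP := hX i; apply.
Qed.

(** Both sides evaluate T at the same element of A on the same arguments; covectors change by the
    Jacobian inverse to that of vectors, acting from the left. *)
Lemma local_rep_change r s (T : tensor A r s) c d th X z : atlas c -> atlas d ->
  tangent_chart_set c A z -> chart_dom d (chart_inv c z.1) ->
  local_rep T c th X z =
  local_rep T d (fun k => change_mx d c (chart_inv c z.1) *m th k)
    (fun l => X l *m change_mx c d (chart_inv c z.1))
    (chart_map d (chart_inv c z.1), z.2 *m change_mx c d (chart_inv c z.1)).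
Proof.
move=> ac ad Uz dq; have [v vE cv] := tangent_chart_setP Uz.
have vq : foot v = chart_inv c z.1 by rewrite /foot vE.
have cq : chart_dom c (chart_inv c z.1) by rewrite -vq.
rewrite /local_rep; have -> : tangent_lift d
  (chart_map d (chart_inv c z.1), z.2 *m change_mx c d (chart_inv c z.1)) = val v.
  rewrite /tangent_lift /= chart_mapK// (of_chartE _ ad dq) -mulmxA.
  have ap := chart_at_atlas (chart_inv c z.1); have pp := chart_at_dom (chart_inv c z.1).
  by rewrite (change_mxM ac ad ap cq dq pp) -(of_chartE _ ac cq) vE.
rewrite -vE (ext0E _ v) (ext0E _ v) -vq.
have ap := chart_at_atlas (foot v); have pp := chart_at_dom (foot v).
rewrite -vq in dq cq.
apply: (f_equal2 (T v)); apply/funext => i.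
  by rewrite mulmxA (change_mxM ap ad ac pp dq cq).
by rewrite -mulmxA (change_mxM ac ad ap cq dq pp).
Qed.

Lemma local_rep_at r s (T : tensor A r s) v th X :
  local_rep T (chart_at (foot v)) th X (lift_chart (chart_at (foot v)) (val v)) =
  T v th X.
Proof.
have ap := chart_at_atlas (foot v); have pp := chart_at_dom (foot v).
rewrite /local_rep (lift_chartK ap pp) ext0E.
by apply: (f_equal2 (T v)); apply/funext => i; rewrite (change_mx_id ap pp) ?mul1mx ?mulmx1.
Qed.

End Jets.

(** * The tensor derivation *)

Section TensorDerivation.
Variables (R : realType) (n : nat) (M : manifold R n) (A : set (tangent M)).
Hypothesis A_open : tangent_open A.
Variables (delta : A -> (M -> 'rV[R]_n) -> 'rV[R]_n) (Z : M -> 'rV[R]_n).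
Hypothesis hdelta : anisotropic_derivation delta Z.
Implicit Types (c d : chart R n M) (p : M) (v : A).

Local Notation Gamma := (christoffel delta).

(* The value at v, in components in the chart c, of the derivation: the
   arguments of the tensor and the fibre coordinate of v are transported along
   Z with velocities given by the connection coefficients. *)
Definition derivation_in r s c (T : tensor A r s) v (th : 'I_r -> 'cV[R]_n)
    (X : 'I_s -> 'rV[R]_n) : R :=
  jet T c (lift_chart c (val v))
    (to_chart c (foot v) (Z (foot v)),
     to_chart c (foot v) (vec (val v)) *m - Gamma c v)
    th (fun k => Gamma c v *m th k) X (fun l => X l *m - Gamma c v).

(** In the preferred chart at the foot point the arguments of a tensor are their own components, so
    no conversion occurs. *)
Definition derivation r s (T : tensor A r s) : tensor A r s :=
  fun v th X => derivation_in (chart_at (foot v)) T v th X.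

(** Affine in t, with the connection coefficients frozen at v; only the position and velocity at t =
    0 will count. *)
Definition curve c v (t : R) : 'rV[R]_n * 'rV[R]_n :=
  (chart_map c (foot v) + t *: to_chart c (foot v) (Z (foot v)),
   to_chart c (foot v) (vec (val v)) *m (1%:M + t *: - Gamma c v)).

Lemma curve0 c v : curve c v 0 = lift_chart c (val v).
Proof. by rewrite /curve !scale0r !addr0 mulmx1. Qed.

Lemma is_derive_curve_TM c v :
  is_derive (0 : R) (1 : R) (curve c v)
    (to_chart c (foot v) (Z (foot v)),
     to_chart c (foot v) (vec (val v)) *m - Gamma c v).
Proof.
apply: is_derive_pair; first exact: is_derive_affine.
have := is_derive_mulmx
  (is_derive_cst (to_chart c (foot v) (vec (val v))) (0 : R) (1 : R))
  (is_derive_affine 1%:M (- Gamma c v)).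
by rewrite mul0mx add0r.
Qed.

Definition cov_curve r c v (th : 'I_r -> 'cV[R]_n) (t : R) k :=
  (1%:M + t *: Gamma c v) *m th k.

Definition vec_curve s c v (X : 'I_s -> 'rV[R]_n) (t : R) l :=
  X l *m (1%:M + t *: - Gamma c v).

Lemma cov_curve0 r c v (th : 'I_r -> 'cV[R]_n) : cov_curve c v th 0 = th.
Proof. by apply/funext => k; rewrite /cov_curve scale0r addr0 mul1mx. Qed.

Lemma vec_curve0 s c v (X : 'I_s -> 'rV[R]_n) : vec_curve c v X 0 = X.
Proof. by apply/funext => k; rewrite /vec_curve scale0r addr0 mulmx1. Qed.

Lemma is_derive_derivation_in r s c (T : tensor A r s) v th X : atensor T ->
  atlas c -> chart_dom c (foot v) ->
  is_derive (0 : R) (1 : R) (fun t => local_rep T c (cov_curve c v th t)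
                                 (vec_curve c v X t) (curve c v t))
    (derivation_in c T v th X).
Proof.
move=> aT ac cv.
have Uz : tangent_chart_set c A (curve c v 0).
  by rewrite curve0; exact: lift_chart_in.
have := is_derive_local_rep A_open aT ac Uz (is_derive_curve_TM c v)
  (fun k => is_derive_covector (Gamma c v) (th k))
  (fun l => is_derive_vector (- Gamma c v) (X l)).
by rewrite curve0 -/(cov_curve c v th 0) -/(vec_curve c v X 0) cov_curve0 vec_curve0.
Qed.

Lemma is_derive_derivation r s (T : tensor A r s) v th X : atensor T ->
  is_derive (0 : R) (1 : R)
    (fun t => local_rep T (chart_at (foot v)) (cov_curve (chart_at (foot v)) v th t)
       (vec_curve (chart_at (foot v)) v X t) (curve (chart_at (foot v)) v t))
    (derivation T v th X).
Proof.
move=> aT; apply: is_derive_derivation_in => //; first exact: chart_at_atlas.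
exact: chart_at_dom.
Qed.

(** The derivative of the Jacobian along Z in intrinsic form. The law for Gamma computes it in the
    chart d, the curves below live in c, and [change_derivE] identifies the two. *)
Definition change_deriv c d v : 'M[R]_n :=
  \matrix_(i, j) tangent_deriv (fun q => change_mx c d q i j) (foot v) (Z (foot v)).

Lemma change_mx_differentiable c d e p : atlas c -> atlas d -> atlas e ->
  chart_dom c p -> chart_dom d p -> chart_dom e p ->
  differentiable (fun x => change_mx c d (chart_inv e x)) (chart_map e p).
Proof.
move=> ac ad ae cp dp ep; apply: differentiable_mx => i j.
have oI := openI (@chart_dom_open _ _ _ c) (@chart_dom_open _ _ _ d).
exact: (smooth_fun_differentiable (f := fun q => change_mx c d q i j)
          ae oI (conj cp dp) ep (smooth_change_mx_fun i j ac ad)).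
Qed.

Lemma change_derivE c d e v : atlas c -> atlas d -> atlas e ->
  chart_dom c (foot v) -> chart_dom d (foot v) -> chart_dom e (foot v) ->
  'D_(to_chart e (foot v) (Z (foot v)))
     (fun x => change_mx c d (chart_inv e x)) (chart_map e (foot v)) =
  change_deriv c d v.
Proof.
move=> ac ad ae cp dp ep; apply/matrixP => i j.
have dC := change_mx_differentiable ac ad ae cp dp ep.
rewrite (derive_entry _ _ _ dC) mxE (tangent_derivE _ ae ep)//.
exact: (differentiable_comp dC (differentiable_coord _ i j)).
Qed.

Lemma christoffel_changeE c d v : atlas c -> atlas d ->
  chart_dom c (foot v) -> chart_dom d (foot v) ->
  Gamma c v *m change_mx c d (foot v) =
  change_deriv c d v + change_mx c d (foot v) *m Gamma d v.
Proof.
by move=> ac ad cp dp; rewrite (christoffel_change hdelta ac ad cp dp)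
  (change_derivE ac ad ad cp dp dp).
Qed.

(** The curves of the chart c, pushed to d by the varying Jacobians, are not those of d, but the
    transformation law of Gamma gives them the velocities required in d. The jets therefore
    agree. *)
Lemma derivation_in_change r s c d (T : tensor A r s) v th X : atensor T ->
  atlas c -> atlas d -> chart_dom c (foot v) -> chart_dom d (foot v) ->
  derivation_in c T v th X =
  derivation_in d T v (fun k => change_mx d c (foot v) *m th k)
    (fun l => X l *m change_mx c d (foot v)).
Proof.
move=> aT ac ad cp dp.
pose q t := chart_inv c (curve c v t).1.
have q0 : q 0 = foot v by rewrite /q /= scale0r addr0 chart_mapK.
have [] := is_derive_curve_TM c v; move=> /derivable1_diffP dcurve _.
have Uzt : \forall t \near (0 : R), tangent_chart_set c A (curve c v t) /\
    chart_dom d (q t).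
  have h1 : \forall z \near curve c v 0, tangent_chart_set c A z.
    apply: open_nbhs_nbhs; split; first exact: A_open.
    by rewrite curve0; exact: lift_chart_in.
  have h2 : \forall x \near (curve c v 0).1, chart_set c (chart_dom d) x.
    apply: open_nbhs_nbhs; split; first exact: overlap_open.
    by rewrite curve0; exact: overlap_map.
  have cc := differentiable_continuous dcurve.
  have cc1 : (fun t => (curve c v t).1) @ (0 : R) --> (curve c v 0).1.
    have [+ _] := is_derive_affine (chart_map c (foot v))
      (to_chart c (foot v) (Z (foot v))).
    by move=> /derivable1_diffP dc1; exact: differentiable_continuous dc1.
  have k1 : \forall t \near (0 : R), tangent_chart_set c A (curve c v t).
    exact: cc _ h1.
  have k2 : \forall t \near (0 : R), chart_set c (chart_dom d) (curve c v t).1.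
    exact: cc1 _ h2.
  by apply: filterS2 k1 k2 => t ? [].
have dx := is_derive_affine (chart_map c (foot v)) (to_chart c (foot v) (Z (foot v))).
have dC a b : atlas a -> atlas b -> chart_dom a (foot v) -> chart_dom b (foot v) ->
    is_derive (0 : R) (1 : R) (fun t => change_mx a b (q t)) (change_deriv a b v).
  move=> aa ab av bv.
  have h : differentiable (fun x => change_mx a b (chart_inv c x))
      (chart_map c (foot v) + 0 *: to_chart c (foot v) (Z (foot v))).
    by rewrite scale0r addr0; exact: change_mx_differentiable.
  have := is_derive_curve dx h.
  by rewrite scale0r addr0 (change_derivE aa ab ac av bv cp).
have h1 := is_derive_derivation_in th X aT ac cp.
(* Let C be the Jacobian from d to c and C' its derivative along Z. The product rule gives (C' + C
   Gamma_c) th, which is Gamma_d C th by the transformation law. *)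
have dtheta k : is_derive (0 : R) (1 : R)
    (fun t => change_mx d c (q t) *m cov_curve c v th t k)
    (Gamma d v *m (change_mx d c (foot v) *m th k)).
  have := is_derive_mulmx (dC _ _ ad ac dp cp) (is_derive_covector (Gamma c v) (th k)).
  rewrite scale0r addr0 mul1mx q0 [_ *m (_ *m th k)]mulmxA -mulmxDl.
  by rewrite -(christoffel_changeE ad ac dp cp) mulmxA.
(* With C now the Jacobian from c to d, the velocity - x Gamma_c C + x C' becomes - x C Gamma_d.
   This serves both the vector arguments and the fibre coordinate of v. *)
have dvec m (x : 'M[R]_(m, n)) : is_derive (0 : R) (1 : R)
    (fun t => (x *m (1%:M + t *: - Gamma c v)) *m change_mx c d (q t))
    (x *m change_mx c d (foot v) *m - Gamma d v).
  have := is_derive_mulmx (is_derive_vector (- Gamma c v) x) (dC _ _ ac ad cp dp).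
  rewrite scale0r addr0 mulmx1 q0.
  have -> // : x *m - Gamma c v *m change_mx c d (foot v) + x *m change_deriv c d v
    = x *m change_mx c d (foot v) *m - Gamma d v.
  rewrite -mulmxA mulNmx (christoffel_changeE ac ad cp dp) !mulmxN -mulmxA mulmxDr.
  by rewrite opprD addrAC addNr add0r.
have dbase : is_derive (0 : R) (1 : R) (fun t => chart_map d (q t))
    (to_chart d (foot v) (Z (foot v))).
  have h : differentiable (fun x => chart_map d (chart_inv c x))
      (chart_map c (foot v) + 0 *: to_chart c (foot v) (Z (foot v))).
    by rewrite scale0r addr0; exact: transition_differentiable.
  have := is_derive_curve dx h; rewrite scale0r addr0.
  rewrite -/(chart_change c d (foot v) _) (chart_changeE ac ad _ cp dp).
  by rewrite -(of_chartK _ ac ad cp dp) (to_chartK _ ac cp).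
pose zd t := (chart_map d (q t), (curve c v t).2 *m change_mx c d (q t)).
have zd0 : zd 0 = lift_chart d (val v).
  rewrite /zd q0 /= scale0r addr0 mulmx1.
  by rewrite -(of_chartK _ ac ad cp dp) (to_chartK _ ac cp).
have Uzd : tangent_chart_set d A (zd 0) by rewrite zd0; exact: lift_chart_in.
have dzd := is_derive_pair dbase (dvec _ (to_chart c (foot v) (vec (val v)))).
have h2 := is_derive_local_rep A_open aT ad Uzd dzd dtheta (fun l => dvec _ (X l)).
(* For small t the curve remains in A and in both charts, so the two local representatives are the
   same function of t. *)
have hn : \forall t \near (0 : R),
    local_rep T d (fun k => change_mx d c (q t) *m cov_curve c v th t k)
      (fun l => vec_curve c v X t l *m change_mx c d (q t)) (zd t) =
    local_rep T c (cov_curve c v th t) (vec_curve c v X t) (curve c v t).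
  by apply: filterS Uzt => t [Ut dt]; rewrite (local_rep_change _ _ _ ac ad Ut dt).
have h3 := near_eq_is_derive hn h2.
have [_ <-] := h1; have [_ ->] := h3; rewrite /derivation_in zd0.
have -> : (fun k => change_mx d c (q 0) *m cov_curve c v th 0 k) =
    (fun k => change_mx d c (foot v) *m th k).
  by apply/funext => k; rewrite cov_curve0 q0.
have -> : (fun l => X l *m (1%:M + 0 *: - Gamma c v) *m change_mx c d (q 0)) =
    (fun l => X l *m change_mx c d (foot v)).
  by apply/funext => k; rewrite scale0r addr0 mulmx1 q0.
have -> // : to_chart c (foot v) (vec (val v)) *m change_mx c d (foot v) =
  to_chart d (foot v) (vec (val v)).
by rewrite -(of_chartK _ ac ad cp dp) (to_chartK _ ac cp).
Qed.

End TensorDerivation.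

(** * Linearity, Leibniz rule and multilinearity *)

Section TensorDerivationRules.
Variables (R : realType) (n : nat) (M : manifold R n) (A : set (tangent M)).
Hypothesis A_open : tangent_open A.
Variables (delta : A -> (M -> 'rV[R]_n) -> 'rV[R]_n) (Z : M -> 'rV[R]_n).
Hypothesis hdelta : anisotropic_derivation delta Z.
Implicit Types (c d : chart R n M) (p : M) (v : A).

Local Notation Gamma := (christoffel delta).
Local Notation D := (derivation delta Z).

Lemma atensor_combination r s (t : R) (T1 T2 : tensor A r s) :
  atensor T1 -> atensor T2 -> atensor (add_tensor (scale_tensor t T1) T2).
Proof.
move=> [[m1 m1'] s1] [[m2 m2'] s2]; split; first split.
- by move=> v th X k a x y; rewrite /add_tensor /scale_tensor m1 m2; ring.
- by move=> v th X k a x y; rewrite /add_tensor /scale_tensor m1' m2'; ring.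
move=> c ac I J; have oU := A_open ac.
apply: (smooth_ext oU _ (smoothD oU (smoothM oU (smooth_cst _ t) (s1 c ac I J))
  (s2 c ac I J))).
by move=> z Uz /=; have [v vE cv] := tangent_chart_setP Uz; rewrite -vE !ext0E.
Qed.

Lemma local_rep_combination r s (t : R) (T1 T2 : tensor A r s) c th X z :
  local_rep (add_tensor (scale_tensor t T1) T2) c th X z =
  t * local_rep T1 c th X z + local_rep T2 c th X z.
Proof.
rewrite /local_rep /ext0; case: insub => [v|] //=.
by rewrite mulr0 addr0.
Qed.

Lemma derivation_linear r s (t : R) (T1 T2 : tensor A r s) :
  atensor T1 -> atensor T2 ->
  D (add_tensor (scale_tensor t T1) T2) = add_tensor (scale_tensor t (D T1)) (D T2).
Proof.
move=> a1 a2; apply/funext => v; apply/funext => th; apply/funext => X.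
have h := is_derive_derivation A_open delta Z v th X (atensor_combination t a1 a2).
have h1 := is_derive_derivation A_open delta Z v th X a1.
have h2 := is_derive_derivation A_open delta Z v th X a2.
apply: (is_derive_unique h).
have := is_deriveD (is_derive_mul (is_derive_cst t _ _) h1) h2.
rewrite mul0r add0r; congr is_derive.
by apply/funext => u; rewrite local_rep_combination.
Qed.

Lemma local_rep_prod r1 s1 r2 s2 (T1 : tensor A r1 s1) (T2 : tensor A r2 s2)
    c th X z :
  local_rep (prod_tensor T1 T2) c th X z =
  local_rep T1 c (th \o lshift r2) (X \o lshift s2) z *
  local_rep T2 c (th \o @rshift r1 r2) (X \o @rshift s1 s2) z.
Proof.
rewrite /local_rep /ext0; case: insub => [v|] //=.
by rewrite mulr0.
Qed.

Lemma atensor_prod r1 s1 r2 s2 (T1 : tensor A r1 s1) (T2 : tensor A r2 s2) :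
  atensor T1 -> atensor T2 -> atensor (prod_tensor T1 T2).
Proof.
move=> [[m1 m1'] sm1] [[m2 m2'] sm2]; split; first split.
- move=> v th X k t a b; rewrite /prod_tensor -(splitK k).
  case: (fintype.split k) => i /=; rewrite /unsplit.
    by rewrite !with_lshift !with_lrshift m1; ring.
  by rewrite !with_rshift !with_rlshift m2; ring.
- move=> v th X k t a b; rewrite /prod_tensor -(splitK k).
  case: (fintype.split k) => i /=; rewrite /unsplit.
    by rewrite !with_lshift !with_lrshift m1'; ring.
  by rewrite !with_rshift !with_rlshift m2'; ring.
move=> c ac I J; have oU := A_open ac.
apply: (smooth_ext oU _ (smoothM oU
  (sm1 c ac (I \o lshift r2) (J \o lshift s2))
  (sm2 c ac (I \o @rshift r1 r2) (J \o @rshift s1 s2)))).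
by move=> z Uz /=; have [v vE cv] := tangent_chart_setP Uz; rewrite -vE !ext0E.
Qed.

(** Slots are transported independently of one another, so the representative of the product is the
    product of the representatives along the curve, and the ordinary product rule applies. *)
Lemma derivation_prod r1 s1 r2 s2 (T1 : tensor A r1 s1) (T2 : tensor A r2 s2) :
  atensor T1 -> atensor T2 ->
  D (prod_tensor T1 T2) =
  add_tensor (prod_tensor (D T1) T2) (prod_tensor T1 (D T2)).
Proof.
move=> a1 a2; apply/funext => v; apply/funext => th; apply/funext => X.
have h := is_derive_derivation A_open delta Z v th X (atensor_prod a1 a2).
have h1 := is_derive_derivation A_open delta Z v (th \o lshift r2) (X \o lshift s2) a1.
have h2 := is_derive_derivation A_open delta Z v
  (th \o @rshift r1 r2) (X \o @rshift s1 s2) a2.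
apply: (is_derive_unique h).
have := is_derive_mul h1 h2.
rewrite !cov_curve0 !vec_curve0 !curve0 !local_rep_at; congr is_derive.
by apply/funext => u; rewrite local_rep_prod.
Qed.

Lemma local_rep_cov_linear r s (T : tensor A r s) c th X z k t a b :
  multilinear T ->
  local_rep T c [eta th with k |-> t *: a + b] X z =
  t * local_rep T c [eta th with k |-> a] X z +
  local_rep T c [eta th with k |-> b] X z.
Proof.
move=> [mth _]; rewrite /local_rep /ext0.
case: insub => [w|] /=; last by rewrite mulr0 addr0.
pose L x : 'cV[R]_n := change_mx (chart_at (foot w)) c (foot w) *m x.
have E x : (fun i => L ([eta th with k |-> x] i)) =
    [eta (fun i => L (th i)) with k |-> L x].
  by apply/funext => i /=; case: eqP.
rewrite (E a) (E b) (E (t *: a + b)) -mth; congr (T w _ _); congr [eta _ with k |-> _].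
by rewrite /L mulmxDr scalemxAr.
Qed.

Lemma local_rep_vec_linear r s (T : tensor A r s) c th X z l t a b :
  multilinear T ->
  local_rep T c th [eta X with l |-> t *: a + b] z =
  t * local_rep T c th [eta X with l |-> a] z +
  local_rep T c th [eta X with l |-> b] z.
Proof.
move=> [_ mX]; rewrite /local_rep /ext0.
case: insub => [w|] /=; last by rewrite mulr0 addr0.
pose L x : 'rV[R]_n := x *m change_mx c (chart_at (foot w)) (foot w).
have E x : (fun i => L ([eta X with l |-> x] i)) =
    [eta (fun i => L (X i)) with l |-> L x].
  by apply/funext => i /=; case: eqP.
rewrite (E a) (E b) (E (t *: a + b)) -mX; congr (T w _ _); congr [eta _ with l |-> _].
by rewrite /L mulmxDl scalemxAl.
Qed.

Lemma cov_curve_with r c v (th : 'I_r -> 'cV[R]_n) k x t :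
  cov_curve delta c v [eta th with k |-> x] t =
  [eta cov_curve delta c v th t with k |-> (1%:M + t *: Gamma c v) *m x].
Proof. by apply/funext => i; rewrite /cov_curve /=; case: eqP. Qed.

Lemma vec_curve_with s c v (X : 'I_s -> 'rV[R]_n) l x t :
  vec_curve delta c v [eta X with l |-> x] t =
  [eta vec_curve delta c v X t with l |-> x *m (1%:M + t *: - Gamma c v)].
Proof. by apply/funext => i; rewrite /vec_curve /=; case: eqP. Qed.

Lemma derivation_multilinear r s (T : tensor A r s) : atensor T ->
  multilinear (D T).
Proof.
move=> aT; have [mT _] := aT; split=> v th X k t a b.
  have h x := is_derive_derivation A_open delta Z v [eta th with k |-> x] X aT.
  apply: (is_derive_unique (h _)).
  have := is_deriveD (is_derive_mul (is_derive_cst t _ _) (h a)) (h b).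
  rewrite mul0r add0r; congr is_derive; apply/funext => u.
  rewrite !cov_curve_with mulmxDr -scalemxAr (local_rep_cov_linear _ _ _ _ _ _ _ _ mT).
  by rewrite fctE !cov_curve_with.
have h x := is_derive_derivation A_open delta Z v th [eta X with k |-> x] aT.
apply: (is_derive_unique (h _)).
have := is_deriveD (is_derive_mul (is_derive_cst t _ _) (h a)) (h b).
rewrite mul0r add0r; congr is_derive; apply/funext => u.
rewrite !vec_curve_with mulmxDl -scalemxAl (local_rep_vec_linear _ _ _ _ _ _ _ _ mT).
by rewrite fctE !vec_curve_with.
Qed.

End TensorDerivationRules.

(** * The derivation of a smooth tensor is smooth *)

Section TensorDerivationClosed.
Variables (R : realType) (n : nat) (M : manifold R n) (A : set (tangent M)).
Hypothesis A_open : tangent_open A.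
Variables (delta : A -> (M -> 'rV[R]_n) -> 'rV[R]_n) (Z : M -> 'rV[R]_n).
Hypothesis hdelta : anisotropic_derivation delta Z.
Implicit Types (c d : chart R n M) (p : M) (v : A).

Local Notation Gamma := (christoffel delta).
Local Notation D := (derivation delta Z).

Lemma smooth_jet r s (T : tensor A r s) c
    (zeta : 'rV[R]_n * 'rV[R]_n -> 'rV[R]_n * 'rV[R]_n)
    (th dth : 'rV[R]_n * 'rV[R]_n -> 'I_r -> 'cV[R]_n)
    (X dX : 'rV[R]_n * 'rV[R]_n -> 'I_s -> 'rV[R]_n) :
  atensor T -> atlas c ->
  (forall j, smooth_on (tangent_chart_set c A) (fun z => (zeta z).1 ord0 j)) ->
  (forall j, smooth_on (tangent_chart_set c A) (fun z => (zeta z).2 ord0 j)) ->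
  (forall k i, smooth_on (tangent_chart_set c A) (fun z => th z k i ord0)) ->
  (forall k i, smooth_on (tangent_chart_set c A) (fun z => dth z k i ord0)) ->
  (forall l i, smooth_on (tangent_chart_set c A) (fun z => X z l ord0 i)) ->
  (forall l i, smooth_on (tangent_chart_set c A) (fun z => dX z l ord0 i)) ->
  smooth_on (tangent_chart_set c A)
    (fun z => jet T c z (zeta z) (th z) (dth z) (X z) (dX z)).
Proof.
move=> aT ac s1 s2 sth sdth sX sdX; have oU := A_open ac; have [_ sT] := aT.
apply: smooth_sum => // I _; apply: smooth_sum => // J _.
have sprod1 : smooth_on (tangent_chart_set c A)
    (fun z => \prod_k th z k (I k) ord0) by apply: smooth_prod.
have sprod2 : smooth_on (tangent_chart_set c A)
    (fun z => \prod_l X z l ord0 (J l)) by apply: smooth_prod.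
have sc : smooth_on (tangent_chart_set c A) (component T c I J) by exact: sT.
apply: smoothD => //; apply: smoothM => //.
- apply: smoothD => //; apply: smoothM => //.
    exact: (@smooth_prod_deriv _ _ _ _ (index_enum 'I_r)
      (fun k z => th z k (I k) ord0) (fun k z => dth z k (I k) ord0) oU).
  exact: (@smooth_prod_deriv _ _ _ _ (index_enum 'I_s)
    (fun l z => X z l ord0 (J l)) (fun l z => dX z l ord0 (J l)) oU).
- exact: smoothM.
(* The direction of differentiation depends on z. Expanding it in the coordinate directions leaves
   derivatives in fixed directions, which are smooth by [smooth_derive]. *)
- apply: (smooth_ext (f := fun z => \sum_(i < n + n)
       (match fintype.split i with
        | inl j => (zeta z).1 ord0 j | inr j => (zeta z).2 ord0 j end) *
       'D_(match fintype.split i with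
           | inl j => (delta_mx ord0 j, 0) | inr j => (0, delta_mx ord0 j) end)
         (component T c I J) z)) => //.
    move=> z Uz; have dc := @component_differentiable _ _ _ _ A_open _ _ T c I J _ aT ac Uz.
    by rewrite [RHS](derive_coordinates _ (@coordinates_TM R n) dc).
  apply: smooth_sum => // i _; apply: smoothM => //.
    by case: fintype.split.
  exact: smooth_derive.
Qed.

(** The definition uses the preferred chart, which need not vary smoothly. [derivation_in_change]
    moves it to the fixed chart c, where coordinate fields and covectors become constant and the
    value is a jet with smooth entries. *)
Lemma atensor_derivation r s (T : tensor A r s) : atensor T -> atensor (D T).
Proof.
move=> aT; split; first exact: derivation_multilinear.
move=> c ac I J; have oU := A_open ac; have [_ sT] := aT.
pose G z : 'M[R]_n := \matrix_(i, j) ext0 (fun v => Gamma c v i j) (tangent_lift c z).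
have sG i j : smooth_on (tangent_chart_set c A) (fun z => G z i j).
  apply: (smooth_ext oU _ (smooth_christoffel A_open hdelta i j ac)).
  by move=> z _; rewrite mxE.
pose zeta z : 'rV[R]_n * 'rV[R]_n :=
  (to_chart c (chart_inv c z.1) (Z (chart_inv c z.1)), z.2 *m - G z).
have sj := @smooth_jet r s T c zeta (fun _ k => delta_mx (I k) ord0)
  (fun z k => G z *m delta_mx (I k) ord0) (fun _ l => delta_mx ord0 (J l))
  (fun z l => delta_mx ord0 (J l) *m - G z) aT ac.
apply: (smooth_ext oU _ (sj _ _ _ _ _ _)).
- move=> z Uz /=; have [v vE cv] := tangent_chart_setP Uz.
  have ap := chart_at_atlas (foot v); have pp := chart_at_dom (foot v).
  rewrite -vE ext0E /derivation.
  have -> : (fun k => coord_covec c (foot v) (I k)) = (fun k =>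
      change_mx (chart_at (foot v)) c (foot v) *m delta_mx (I k) ord0).
    by apply/funext => k; rewrite (coord_covecE _ ac cv).
  have -> : (fun l => coord_vec c (foot v) (J l)) = (fun l =>
      delta_mx ord0 (J l) *m change_mx c (chart_at (foot v)) (foot v)).
    by apply/funext => l; rewrite (coord_vecE _ ac cv).
  rewrite -(derivation_in_change A_open hdelta _ _ aT ac ap cv pp).
  have zE : lift_chart c (val v) = z by rewrite vE tangent_liftK//; case: Uz.
  have GE : G z = Gamma c v by apply/matrixP => i j; rewrite mxE -vE ext0E.
  have vz : chart_inv c z.1 = foot v by rewrite /foot vE.
  by rewrite /derivation_in zE /zeta GE vz -zE.
- move=> j /=; have := (smooth_vfieldP _ openT).1 (ader_vfield hdelta) c ac j.
  rewrite chart_setT => /(smooth_base (@chart_cod_open _ _ _ c)).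
  by apply: smooth_mono => z [].
- move=> j; apply: (smooth_ext (f := fun z : 'rV[R]_n * 'rV[R]_n =>
    \sum_i z.2 ord0 i * (-1 * G z i j))) => //.
    move=> z _; rewrite [RHS]mxE; apply: eq_bigr => i _.
    by rewrite mulN1r; congr (_ * _); rewrite [RHS]mxE.
  apply: smooth_sum => // i _; apply: smoothM => //; first exact: smooth_fibre_coord.
  by apply: smoothM => //; exact: smooth_cst.
- by move=> k i; exact: smooth_cst.
- move=> k i; apply: smooth_ext (sG i (I k)) => // z _.
  by rewrite -colE [RHS]mxE.
- by move=> k i; exact: smooth_cst.
- move=> l i; apply: (smooth_ext (f := fun z : 'rV[R]_n * 'rV[R]_n =>
    -1 * G z (J l) i)) => //.
    by move=> z _; rewrite -rowE mulN1r [RHS]mxE [RHS]mxE.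
  by apply: smoothM => //; exact: smooth_cst.
Qed.

End TensorDerivationClosed.

(** * Commutation with contractions *)

Section Contraction.
Variables (R : realType) (n : nat) (M : manifold R n) (A : set (tangent M)).
Hypothesis A_open : tangent_open A.
Variables (delta : A -> (M -> 'rV[R]_n) -> 'rV[R]_n) (Z : M -> 'rV[R]_n).
Hypothesis hdelta : anisotropic_derivation delta Z.
Implicit Types (c d : chart R n M) (p : M) (v : A).

Local Notation Gamma := (christoffel delta).
Local Notation D := (derivation delta Z).

(** P and Q are arbitrary because this will be applied to 1 + t Gamma and 1 - t Gamma, which are
    inverse to each other only up to first order. *)
Lemma trace_change (B : 'cV[R]_n -> 'rV[R]_n -> R) (P Q : 'M[R]_n) :
  (forall t x y w, B (t *: x + y) w = t * B x w + B y w) ->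
  (forall t x y w, B w (t *: x + y) = t * B w x + B w y) ->
  \sum_a B (P *m delta_mx a ord0) (delta_mx ord0 a *m Q) =
  \sum_i \sum_j (P *m Q) i j * B (delta_mx i ord0) (delta_mx ord0 j).
Proof.
move=> Bl Br.
have E a : B (P *m delta_mx a ord0) (delta_mx ord0 a *m Q) =
    \sum_i \sum_j P i a * Q a j * B (delta_mx i ord0) (delta_mx ord0 j).
  have -> : P *m delta_mx a ord0 = \sum_i P i a *: (delta_mx i ord0 : 'cV[R]_n).
    rewrite -colE [LHS]matrix_sum_delta; apply: eq_bigr => i _.
    by rewrite big_ord1 mxE.
  rewrite (scalar_linear_sum (f := B^~ _)) //; apply: eq_bigr => i _.
  have -> : delta_mx ord0 a *m Q = \sum_j Q a j *: (delta_mx ord0 j : 'rV[R]_n).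
    by rewrite -rowE [LHS]row_sum_delta; apply: eq_bigr => j _; rewrite mxE.
  rewrite (scalar_linear_sum (f := B _)) // mulr_sumr; apply: eq_bigr => j _.
  by rewrite mulrA.
under eq_bigr do rewrite E; rewrite exchange_big; apply: eq_bigr => i _ /=.
rewrite exchange_big; apply: eq_bigr => j _ /=.
by rewrite mxE mulr_suml.
Qed.

Lemma trace_invariant (B : 'cV[R]_n -> 'rV[R]_n -> R) (P Q : 'M[R]_n) :
  (forall t x y w, B (t *: x + y) w = t * B x w + B y w) ->
  (forall t x y w, B w (t *: x + y) = t * B w x + B w y) ->
  P *m Q = 1%:M ->
  \sum_a B (P *m delta_mx a ord0) (delta_mx ord0 a *m Q) =
  \sum_a B (delta_mx a ord0) (delta_mx ord0 a).
Proof.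
move=> Bl Br PQ; rewrite trace_change// PQ; apply: eq_bigr => i _.
rewrite (bigD1 i)//= mxE eqxx mul1r big1 ?addr0// => j ji.
by rewrite mxE eq_sym (negPf ji) mul0r.
Qed.

Lemma insert_linear_cov r s (T : tensor A r.+1 s) v k th X :
  multilinear T -> forall t x y,
  T v (insert_at k (t *: x + y) th) X =
  t * T v (insert_at k x th) X + T v (insert_at k y th) X.
Proof.
move=> [mT _] t x y; rewrite (with_insert_at _ _ 0) mT.
by rewrite -!with_insert_at.
Qed.

Lemma insert_linear_vec r s (T : tensor A r s.+1) v l th X :
  multilinear T -> forall t x y,
  T v th (insert_at l (t *: x + y) X) =
  t * T v th (insert_at l x X) + T v th (insert_at l y X).
Proof.
move=> [_ mT] t x y; rewrite (with_insert_at _ _ 0) mT.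
by rewrite -!with_insert_at.
Qed.

Lemma multilinear_contraction r s (k : 'I_r.+1) (l : 'I_s.+1)
  (T : tensor A r.+1 s.+1) : multilinear T -> multilinear (Defs.contraction k l T).
Proof.
move=> [mth mX]; split=> v th X i t a b; rewrite /Defs.contraction mulr_sumr -big_split.
  by apply: eq_bigr => j _; rewrite !insert_at_with mth.
by apply: eq_bigr => j _; rewrite !insert_at_with mX.
Qed.

Lemma atensor_contraction r s (k : 'I_r.+1) (l : 'I_s.+1) (T : tensor A r.+1 s.+1) :
  atensor T -> atensor (Defs.contraction k l T).
Proof.
move=> [mT sT]; split; first exact: multilinear_contraction.
move=> c ac I J; have oU := A_open ac.
apply: (smooth_ext oU _ (smooth_sum (index_enum 'I_n) (P := predT) oU
  (fun a _ => sT c ac (insert_at k a I) (insert_at l a J)))).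
move=> z Uz /=; have [v vE cv] := tangent_chart_setP Uz.
rewrite -vE ext0E; under eq_bigr do rewrite ext0E.
have ap := chart_at_atlas (foot v); have pp := chart_at_dom (foot v).
rewrite /Defs.contraction.
rewrite -(trace_invariant (B := fun a x => T v (insert_at k a _) (insert_at l x _))
  _ _ (change_mxV ap ac pp cv)); first last.
- by move=> *; exact: insert_linear_vec.
- by move=> *; exact: insert_linear_cov.
apply: eq_bigr => a _.
rewrite (insert_at_map (coord_covec c (foot v))) (insert_at_map (coord_vec c (foot v))).
by rewrite (coord_covecE _ ac cv) (coord_vecE _ ac cv).
Qed.

Lemma local_rep_contraction r s (k : 'I_r.+1) (l : 'I_s.+1)
    (T : tensor A r.+1 s.+1) c th X z : multilinear T -> atlas c ->
  tangent_chart_set c A z ->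
  local_rep (Defs.contraction k l T) c th X z =
  \sum_a local_rep T c (insert_at k (delta_mx a ord0) th)
    (insert_at l (delta_mx ord0 a) X) z.
Proof.
move=> mT ac Uz; have [v vE cv] := tangent_chart_setP Uz.
have ap := chart_at_atlas (foot v); have pp := chart_at_dom (foot v).
rewrite /local_rep -vE (ext0E _ v); under [RHS]eq_bigr do rewrite (ext0E _ v).
rewrite /Defs.contraction.
rewrite -(trace_invariant (B := fun a x => T v (insert_at k a _) (insert_at l x _))
  _ _ (change_mxV ap ac pp cv)); first last.
- by move=> *; exact: insert_linear_vec.
- by move=> *; exact: insert_linear_cov.
apply: eq_bigr => a _.
by rewrite (insert_at_map (mulmx _)) (insert_at_map (mulmxr _)).
Qed.

(** The derivative of the contraction keeps the inserted dual bases fixed along the curve, whereas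
    contracting [D T] transports them. By [trace_change] the transported sum is the pairing of the
    matrix b of representatives with P Q, and P Q is the identity up to first order. *)
Lemma derivation_contraction r s (k : 'I_r.+1) (l : 'I_s.+1)
    (T : tensor A r.+1 s.+1) : atensor T ->
  D (Defs.contraction k l T) = Defs.contraction k l (D T).
Proof.
move=> aT; have [mT _] := aT.
apply/funext => v; apply/funext => th; apply/funext => X.
have ac := chart_at_atlas (foot v); have cv := chart_at_dom (foot v).
have h1 := is_derive_derivation A_open delta Z v th X (atensor_contraction k l aT).
set c := chart_at (foot v) in ac cv h1.
have Uz : tangent_chart_set c A (curve delta Z c v 0).
  by rewrite curve0; exact: lift_chart_in.
have Uzt : \forall t \near (0 : R), tangent_chart_set c A (curve delta Z c v t).
  have [/derivable1_diffP dcurve _] := is_derive_curve_TM delta Z c v.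
  have cc := differentiable_continuous dcurve.
  by apply: cc; apply: open_nbhs_nbhs; split=> //; exact: A_open.
pose b i j t := local_rep T c
  (insert_at k (delta_mx i ord0) (cov_curve delta c v th t))
  (insert_at l (delta_mx ord0 j) (vec_curve delta c v X t)) (curve delta Z c v t).
have [db hb] : exists db : 'I_n -> 'I_n -> R,
    forall i j, is_derive (0 : R) (1 : R) (b i j) (db i j).
  (* The inserted basis elements are constant, hence velocity 0 in slots k and l. Only the existence
     of these derivatives is used afterwards. *)
  pose dth := insert_at k 0 (fun m => Gamma c v *m th m).
  pose dX := insert_at l 0 (fun m => X m *m - Gamma c v).
  exists (fun i j => jet T c (curve delta Z c v 0)
    (to_chart c (foot v) (Z (foot v)), to_chart c (foot v) (vec (val v)) *m - Gamma c v)
    (insert_at k (delta_mx i ord0) (cov_curve delta c v th 0)) dth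
    (insert_at l (delta_mx ord0 j) (vec_curve delta c v X 0)) dX) => i j.
  apply: (is_derive_local_rep A_open aT ac Uz (is_derive_curve_TM delta Z c v)
    (th := fun t => insert_at k (delta_mx i ord0) (cov_curve delta c v th t))
    (X := fun t => insert_at l (delta_mx ord0 j) (vec_curve delta c v X t))) => m.
    rewrite /dth; have [m' ->|->] := unliftP k m.
      rewrite insert_at_lift; under eq_fun do rewrite insert_at_lift.
      exact: is_derive_covector.
    rewrite insert_at_same; under eq_fun do rewrite insert_at_same.
    exact: is_derive_cst.
  rewrite /dX; have [m' ->|->] := unliftP l m.
    rewrite insert_at_lift; under eq_fun do rewrite insert_at_lift.
    exact: is_derive_vector.
  rewrite insert_at_same; under eq_fun do rewrite insert_at_same.
  exact: is_derive_cst.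
have h2 : is_derive (0 : R) (1 : R) (fun t => \sum_a b a a t) (\sum_a db a a).
  exact: (is_derive_sumr (index_enum 'I_n) (P := predT) (fun a _ => hb a a)).
have e1 : \forall t \near (0 : R), \sum_a b a a t =
    local_rep (Defs.contraction k l T) c (cov_curve delta c v th t)
      (vec_curve delta c v X t) (curve delta Z c v t).
  by apply: filterS Uzt => t Ut; rewrite local_rep_contraction.
have h1' := near_eq_is_derive e1 h2.
have -> := is_derive_unique h1 h1'; rewrite /Defs.contraction.
pose P t : 'M[R]_n := 1%:M + t *: Gamma c v.
pose Q t : 'M[R]_n := 1%:M + t *: - Gamma c v.
(* The two frames stay dual to first order along the curve. *)
have dPQ : is_derive (0 : R) (1 : R) (fun t => P t *m Q t) 0.
  have := is_derive_mulmx (is_derive_affine 1%:M (Gamma c v))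
    (is_derive_affine 1%:M (- Gamma c v)).
  by rewrite !scale0r !addr0 mulmx1 mul1mx subrr.
(* Since P Q is the identity at 0 with derivative 0, weighting b by P Q gives the same derivative as
   the plain trace. *)
have h3 : is_derive (0 : R) (1 : R)
    (fun t => \sum_i \sum_j (P t *m Q t) i j * b i j t) (\sum_a db a a).
  have -> : \sum_a db a a = \sum_i \sum_j
      ((0 : 'M[R]_n) i j * b i j 0 + (P 0 *m Q 0) i j * db i j).
    apply: eq_bigr => i _; rewrite /P /Q !scale0r !addr0 mulmx1 (bigD1 i)//=.
    rewrite !mxE eqxx mul0r add0r mul1r big1 ?addr0// => j ji.
    by rewrite !mxE eq_sym (negPf ji) !mul0r addr0.
  apply: is_derive_sumr => i _; apply: is_derive_sumr => j _.
  by apply: is_derive_mul => //; have /is_derive_mxP := dPQ; apply.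
(* The same weighted sum, read as the sum of representatives with transported dual bases, has the
   contraction of [D T] as its derivative. *)
have h4 : is_derive (0 : R) (1 : R)
    (fun t => \sum_i \sum_j (P t *m Q t) i j * b i j t)
    (\sum_a D T v (insert_at k (delta_mx a ord0) th) (insert_at l (delta_mx ord0 a) X)).
  have h5 := is_derive_sumr (index_enum 'I_n) (P := predT) (fun a _ =>
    is_derive_derivation A_open delta Z v (insert_at k (delta_mx a ord0) th)
      (insert_at l (delta_mx ord0 a) X) aT).
  have -> // : (fun t => \sum_i \sum_j (P t *m Q t) i j * b i j t) = 
    (fun t => \sum_a local_rep T c
       (cov_curve delta c v (insert_at k (delta_mx a ord0) th) t)
       (vec_curve delta c v (insert_at l (delta_mx ord0 a) X) t) (curve delta Z c v t)).
  apply/funext => t.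
  rewrite -(trace_change (B := fun a x => local_rep T c
    (insert_at k a (cov_curve delta c v th t))
    (insert_at l x (vec_curve delta c v X t)) (curve delta Z c v t))).
  - apply: eq_bigr => a _.
    by rewrite /cov_curve /vec_curve (insert_at_map (mulmx _)) (insert_at_map (mulmxr _)).
  - move=> u x y w; rewrite (with_insert_at k _ 0) local_rep_cov_linear//.
    by rewrite -!with_insert_at.
  - move=> u x y w; rewrite (with_insert_at l _ 0) local_rep_vec_linear//.
    by rewrite -!with_insert_at.
exact: is_derive_unique h3 h4.
Qed.

End Contraction.

(** * The prescribed values on vector fields and on functions *)

Section ExtendsDerivation.
Variables (R : realType) (n : nat) (M : manifold R n) (A : set (tangent M)).
Hypothesis A_open : tangent_open A.
Variables (delta : A -> (M -> 'rV[R]_n) -> 'rV[R]_n) (Z : M -> 'rV[R]_n).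
Hypothesis hdelta : anisotropic_derivation delta Z.
Implicit Types (c d : chart R n M) (p : M) (v : A).

Local Notation Gamma := (christoffel delta).
Local Notation D := (derivation delta Z).

Lemma atensor_scalar (h : A -> R) : smooth_afun h -> atensor (scalar_tensor h).
Proof. by move=> sh; split=> [|c ac I J]; [split=> ? ? ? []|exact: sh]. Qed.

Lemma atensor_vfield (X : M -> 'rV[R]_n) :
  smooth_vfield setT X -> atensor (vfield_tensor X : tensor A 1 0).
Proof.
move=> sX; split; first split.
- move=> v th Y k t a b; rewrite /vfield_tensor /vector_tensor /pairing /= !ord1 eqxx.
  by rewrite mulmxDr -scalemxAr !mxE.
- by move=> v th Y [].
move=> c ac I J; have oU := A_open ac.
have := (smooth_vfieldP _ openT).1 sX c ac (I ord0).
rewrite chart_setT => /(smooth_base (@chart_cod_open _ _ _ c)) sX0.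
have sXU := smooth_mono (U := tangent_chart_set c A) (fun z Uz => Uz.1) sX0.
apply: (smooth_ext oU _ sXU) => z Uz /=.
have [v vE cv] := tangent_chart_setP Uz; rewrite -vE ext0E.
have -> : chart_inv c z.1 = foot v by rewrite /foot vE.
rewrite /vfield_tensor /vector_tensor /pairing (coord_covecE _ ac cv) mulmxA.
by rewrite -(to_chartE _ ac cv) -colE mxE.
Qed.

(** In a chart the representative along the curve is W(x + t z) (1 + t Gamma) th, where W and z are
    the components of X and Z. Its derivative is (D_z W + W Gamma) th, which [delta_chart]
    identifies. *)
Lemma derivation_vfield (X : M -> 'rV[R]_n) : smooth_vfield setT X ->
  D (vfield_tensor X : tensor A 1 0) = vector_tensor (fun v => delta v X).
Proof.
move=> sX; apply/funext => v; apply/funext => th; apply/funext => Y.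
have aX := atensor_vfield sX.
have h := is_derive_derivation A_open delta Z v th Y aX.
have ac := chart_at_atlas (foot v); have cv := chart_at_dom (foot v).
set c := chart_at (foot v) in ac cv h.
pose W x := to_chart c (chart_inv c x) (X (chart_inv c x)).
have dx := is_derive_affine (chart_map c (foot v)) (to_chart c (foot v) (Z (foot v))).
have dW : differentiable W
    (chart_map c (foot v) + 0 *: to_chart c (foot v) (Z (foot v))).
  rewrite scale0r addr0.
  exact: (smooth_vfield_differentiable ac openT I cv sX).
have h1 := is_derive_mulmx (is_derive_curve dx dW)
  (is_derive_covector (Gamma c v) (th ord0)).
have /is_derive_mxP/(_ ord0 ord0) h2 := h1.
have Uzt : \forall t \near (0 : R), tangent_chart_set c A (curve delta Z c v t).
  have [/derivable1_diffP dcurve _] := is_derive_curve_TM delta Z c v.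
  have cc := differentiable_continuous dcurve.
  apply: cc; apply: open_nbhs_nbhs; split; first exact: A_open.
  by rewrite curve0; exact: lift_chart_in.
have e1 : \forall t \near (0 : R), ((W \o (fun t => chart_map c (foot v) +
      t *: to_chart c (foot v) (Z (foot v)))) t *m
      ((1%:M + t *: Gamma c v) *m th ord0)) ord0 ord0 =
    local_rep (vfield_tensor X : tensor A 1 0) c (cov_curve delta c v th t)
      (vec_curve delta c v Y t) (curve delta Z c v t).
  apply: filterS Uzt => t Ut; have [w wE cw] := tangent_chart_setP Ut.
  have q : foot w = chart_inv c (curve delta Z c v t).1 by rewrite /foot wE.
  rewrite /local_rep -wE (ext0E _ w) /vfield_tensor /vector_tensor /pairing.
  by rewrite [in RHS]mulmxA -(to_chartE _ ac cw) q.
have h3 := near_eq_is_derive e1 h2.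
have -> := is_derive_unique h h3.
have W0 : W (chart_map c (foot v)) = to_chart c (foot v) (X (foot v)).
  by rewrite /W chart_mapK.
rewrite /= !scale0r !addr0 mul1mx mulmxA -mulmxDl W0.
have := delta_chart hdelta ac cv sX.
by rewrite -/c => <-; rewrite {1}/c to_chart_at.
Qed.

(** All three terms are derivatives of h in one chart at one point (x, y): in the direction (z, - y
    Gamma) for D, (z, a) for h(V) with a = D_z V, and (0, w) for the vertical derivative. As w = a +
    y Gamma by [delta_chart], linearity of the differential of h gives the formula. *)
Lemma derivation_scalar (h : A -> R) v O V w th X : smooth_afun h ->
  open O -> O (foot v) -> smooth_vfield O V ->
  V (foot v) = vec (val v) -> delta_local delta v V w ->
  D (scalar_tensor h) v th X =
  tangent_deriv (afun_comp h V) (foot v) (Z (foot v)) - vertical_deriv h v w.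
Proof.
move=> sh oO Ov sV Vv [W [sW WV wE]].
have h0 := is_derive_derivation A_open delta Z v th X (atensor_scalar sh).
have ac := chart_at_atlas (foot v); have cv := chart_at_dom (foot v).
set c := chart_at (foot v) in ac cv h0.
pose hc := ext0 h \o tangent_lift c.
have Uz : tangent_chart_set c A (lift_chart c (val v)) by exact: lift_chart_in.
pose p := foot v; pose y := vec (val v); pose z := Z (foot v).
have zE : lift_chart c (val v) = (chart_map c p, y).
  by rewrite /lift_chart /= {2}/c to_chart_at.
have dhc : differentiable hc (chart_map c p, y).
  rewrite -zE; apply: (smooth_differentiable (@coordinates_TM R n) _ _ Uz).
    exact: A_open.
  exact: sh.
have DE : D (scalar_tensor h) v th X = 'D_(z, y *m - Gamma c v) hc (chart_map c p, y).
  have := is_derive_curve (is_derive_curve_TM delta Z c v) (f := hc).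
  rewrite curve0 zE => /(_ dhc) h1; have -> := is_derive_unique h0 h1.
  by rewrite /c !to_chart_at.
pose Vc x := to_chart c (chart_inv c x) (V (chart_inv c x)).
have dV : differentiable Vc (chart_map c p).
  exact: (smooth_vfield_differentiable ac oO Ov cv sV).
have VcE : Vc (chart_map c p) = y by rewrite /Vc chart_mapK// Vv {1}/c to_chart_at.
pose a := 'D_z Vc (chart_map c p).
have TE : tangent_deriv (afun_comp h V) p z = 'D_(z, a) hc (chart_map c p, y).
  have dg : is_derive (chart_map c p) z (fun x => (x, Vc x)) (z, a).
    exact: is_derive_pair (is_derive_id _ _) (is_derive_diff _ dV).
  have := is_derive_chain (g := hc) dg; rewrite VcE => /(_ dhc) [_ <-].
  rewrite /tangent_deriv; apply: near_eq_derive.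
  apply: filterS (near_chart cv filterT) => x [cx _].
  rewrite /afun_comp /hc /Vc /= /tangent_lift /=.
  by rewrite (to_chartK _ ac (chart_inv_dom cx)).
have VE : vertical_deriv h v w = 'D_(0, w) hc (chart_map c p, y).
  rewrite /vertical_deriv derive1E.
  have dg := is_derive_pair (is_derive_cst (chart_map c p) (0 : R) (1 : R))
    (is_derive_affine y w).
  pose g (t : R) : 'rV[R]_n * 'rV[R]_n := (cst (chart_map c p) t, y + t *: w).
  have g0 : g 0 = (chart_map c p, y) by rewrite /g scale0r addr0.
  have -> : (fun t : R => ext0 h (Tangent (foot v) (vec (val v) + t *: w))) = hc \o g.
    apply/funext => t; rewrite /hc /= /tangent_lift /= chart_mapK//.
    by rewrite /c of_chart_at.
  have h1 := is_derive_curve (f := hc) (z := g) dg; rewrite g0 in h1.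
  by have [_ E] := h1 dhc.
have ca u : to_chart c p u = u by exact: to_chart_at.
have WVx : \forall x \near chart_map c p,
    to_chart c (chart_inv c x) (W (chart_inv c x)) = Vc x.
  by apply: filterS (near_chart cv WV) => x [cx]; rewrite /Vc => ->.
have wa : w = a + y *m Gamma c v.
  have := delta_chart hdelta ac cv sW.
  by rewrite -/p (nbhs_singleton WV) Vv -wE !ca (near_eq_derive _ WVx).
rewrite -/p -/z TE VE DE; apply/eqP; rewrite eq_sym subr_eq; apply/eqP.
rewrite !deriveE// -linearD; congr ('d hc _ _).
apply/eqP; rewrite xpair_eqE /=; apply/andP; split; first by rewrite addr0.
by rewrite wa mulmxN addrCA addNr addr0.
Qed.

Lemma derivation_extends : extends_derivation delta Z (fun r s => @derivation R n M A delta Z r s).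
Proof.
split; first exact: derivation_vfield.
move=> h sh v O V w oO Ov [sV _] Vv dw th X.
exact: (derivation_scalar th X sh oO Ov sV Vv dw).
Qed.

Lemma derivation_tensor_derivation :
  tensor_derivation (fun r s => @derivation R n M A delta Z r s).
Proof.
split.
- by move=> r s T; exact: atensor_derivation.
- by move=> r s t T1 T2; exact: derivation_linear.
- by move=> r1 s1 r2 s2 T1 T2; exact: derivation_prod.
- by move=> r s k l T; exact: derivation_contraction.
Qed.

End ExtendsDerivation.

(** * Uniqueness *)

Section Uniqueness.
Variables (R : realType) (n : nat) (M : manifold R n) (A : set (tangent M)).
Hypothesis A_open : tangent_open A.
Implicit Types (c d : chart R n M) (p : M) (v : A).

Lemma vfield_through p (w : 'rV[R]_n) :
  exists2 W : M -> 'rV[R]_n, smooth_vfield setT W & W p = w.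
Proof.
have ap := chart_at_atlas p; have pp := chart_at_dom p.
have [W sW We] := smooth_vfield_extend (@chart_dom_open _ _ _ (chart_at p)) pp
  (smooth_const_vfield w ap).
by exists W => //; rewrite (nbhs_singleton We) of_chart_at.
Qed.

(** Extend to M the germ at p of the function that is linear in the preferred chart with
    coefficients a. *)
Lemma differential_through p (a : 'cV[R]_n) :
  exists2 g : M -> R, smooth_fun setT g &
    forall w, tangent_deriv g p w = pairing a w.
Proof.
have ap := chart_at_atlas p; have pp := chart_at_dom p.
set c := chart_at p in ap pp; have oc := @chart_dom_open _ _ _ c.
have sl : smooth_fun (chart_dom c) (fun q => \sum_j chart_map c q ord0 j * a j ord0).
  move=> d ad; apply: smooth_sum; first exact: open_chart_set.
  move=> j _; apply: smoothM; first exact: open_chart_set.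
    exact: (smooth_chart_map j ap ad).
  exact: smooth_cst.
have [g sg ge] := smooth_fun_extend oc pp sl; exists g => // w.
have h : is_derive (chart_map c p) w (fun x : 'rV[R]_n => x *m a) (w *m a).
  have := is_derive_mulmx (is_derive_id (chart_map c p) w)
    (is_derive_cst a (chart_map c p) w).
  by rewrite mulmx0 addr0.
have /is_derive_mxP/(_ ord0 ord0) [_ h1] := h.
rewrite /pairing -h1 /tangent_deriv -/c; apply: near_eq_derive.
apply: filterS (near_chart pp ge) => x [cx /= ->]; rewrite mxE.
by rewrite chart_invK.
Qed.

Definition differential (g : M -> R) : tensor A 0 1 :=
  fun v _ X => tangent_deriv g (foot v) (X ord0).

Lemma atensor_differential g : smooth_fun setT g -> atensor (differential g).
Proof.
move=> sg; have dg c p : atlas c -> chart_dom c p ->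
    differentiable (g \o chart_inv c) (chart_map c p).
  by move=> ac cp; exact: (smooth_fun_differentiable ac openT I cp sg).
split; first split.
- by move=> v th X [].
- move=> v th X k t x y; rewrite /differential /= !ord1 eqxx /tangent_deriv.
  by rewrite deriveDir//; apply: dg; [exact: chart_at_atlas|exact: chart_at_dom].
move=> c ac I J; have oU := A_open ac.
have := smooth_derive (delta_mx ord0 (J ord0)) (sg c ac).
rewrite chart_setT => /(smooth_base (@chart_cod_open _ _ _ c)) sg0.
have sgU := smooth_mono (U := tangent_chart_set c A) (fun z Uz => Uz.1) sg0.
apply: (smooth_ext oU _ sgU) => z Uz /=.
have [v vE cv] := tangent_chart_setP Uz; rewrite -vE ext0E /differential.
rewrite (tangent_derivE _ ac cv (dg _ _ ac cv)) (of_chartK _ ac ac cv cv).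
rewrite (change_mx_id ac cv) mulmx1.
have -> // : chart_map c (foot v) = z.1.
by rewrite /foot vE /= chart_invK//; case: Uz.
Qed.

Lemma contraction_vfield r s (W : M -> 'rV[R]_n) (T : tensor A r s.+1) v th X :
  multilinear T ->
  @Defs.contraction R n M A r s ord0 ord0 (prod_tensor (vfield_tensor W) T) v th X =
  T v th (insert_at ord0 (W (foot v)) X).
Proof.
move=> mT; rewrite /Defs.contraction {1}[W (foot v)]row_sum_delta.
rewrite (scalar_linear_sum (f := fun x => T v th (insert_at ord0 x X))); last first.
  by move=> *; exact: insert_linear_vec.
apply: eq_bigr => a _; rewrite /prod_tensor; congr (_ * _).
  rewrite /vfield_tensor /vector_tensor /pairing /=.
  have -> : lshift r (ord0 : 'I_1) = ord0 :> 'I_r.+1 by exact: val_inj.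
  by rewrite insert_at_same -colE mxE.
congr (T v _ _); apply/funext => i /=.
  have -> : rshift 1 i = lift ord0 i :> 'I_r.+1 by exact: val_inj.
  by rewrite insert_at_lift.
by congr (insert_at _ _ _ _); exact: val_inj.
Qed.

Lemma contraction_differential r s g (T : tensor A r.+1 s) v th X a :
  multilinear T -> (forall w, tangent_deriv g (foot v) w = pairing a w) ->
  @Defs.contraction R n M A r s ord0 ord0 (prod_tensor (differential g) T) v th X =
  T v (insert_at ord0 a th) X.
Proof.
move=> mT ga; have aE : a = \sum_i a i ord0 *: (delta_mx i ord0 : 'cV[R]_n).
  by rewrite [LHS]matrix_sum_delta; apply: eq_bigr => i _; rewrite big_ord1.
rewrite /Defs.contraction [in RHS]aE.
rewrite (scalar_linear_sum (f := fun x => T v (insert_at ord0 x th) X)); last first.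
  by move=> *; exact: insert_linear_cov.
apply: eq_bigr => b _; rewrite /prod_tensor; congr (_ * _).
  rewrite /differential /=.
  have -> : lshift s (ord0 : 'I_1) = ord0 :> 'I_s.+1 by exact: val_inj.
  by rewrite insert_at_same ga /pairing -rowE mxE.
congr (T v _ _); apply/funext => i /=.
  by congr (insert_at _ _ _ _); exact: val_inj.
have -> : rshift 1 i = lift ord0 i :> 'I_s.+1 by exact: val_inj.
by rewrite insert_at_lift.
Qed.

Variables (delta : A -> (M -> 'rV[R]_n) -> 'rV[R]_n) (Z : M -> 'rV[R]_n).

(** Because A is open, a smooth field through v stays in A over a neighbourhood of the foot point.
    Hence the formula on functions can be applied at every v. *)
Lemma admissible_field v : exists O W, [/\ open O, O (foot v),
  smooth_vfield setT W, admissible A O W & W (foot v) = vec (val v)].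
Proof.
have [W sW Wv] := vfield_through (foot v) (vec (val v)).
have ac := chart_at_atlas (foot v); have cv := chart_at_dom (foot v).
set c := chart_at (foot v) in ac cv.
pose Wc x := to_chart c (chart_inv c x) (W (chart_inv c x)).
have dW : differentiable Wc (chart_map c (foot v)).
  exact: (smooth_vfield_differentiable ac openT I cv sW).
have dg : differentiable (fun x : 'rV[R]_n => (x, Wc x)) (chart_map c (foot v)).
  exact: differentiable_pair.
have U0 : tangent_chart_set c A (chart_map c (foot v), Wc (chart_map c (foot v))).
  have -> : Wc (chart_map c (foot v)) = to_chart c (foot v) (vec (val v)).
    by rewrite /Wc (chart_mapK cv) Wv.
  exact: (lift_chart_in ac cv).
have : \forall x \near chart_map c (foot v), tangent_chart_set c A (x, Wc x).
  apply: (differentiable_continuous dg); apply: open_nbhs_nbhs; split=> //.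
  exact: A_open.
move=> /(near_point cv)/near_openP [ O [oO Ov OA] ].
exists O, W; split=> //; split; first exact: smooth_vfield_mono sW.
move=> q /OA [cq [_]]; rewrite /tangent_lift /Wc /= chart_mapK//.
by rewrite (to_chartK _ ac cq).
Qed.

Variables D1 D2 : forall r s, tensor A r s -> tensor A r s.
Hypotheses (tD1 : tensor_derivation D1) (tD2 : tensor_derivation D2).
Hypotheses (eD1 : extends_derivation delta Z D1) (eD2 : extends_derivation delta Z D2).

Lemma derivation_unique_scalar (T : tensor A 0 0) : atensor T ->
  D1 T = D2 T.
Proof.
move=> aT; pose h v : R := T v (fun _ => 0) (fun _ => 0).
have TE : T = scalar_tensor h.
  apply/funext => v; apply/funext => th; apply/funext => X.
  by congr (T v _ _); apply/funext => -[].
have sh : smooth_afun h.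
  move=> c ac; have [_ sT] := aT; have oU := A_open ac.
  (* The dimension n may be 0, so there is no default index in ['I_n]; the families indexed by
     ['I_0] are defined by empty elimination. *)
  apply: (smooth_ext oU _ (sT c ac (fun i => match i with Ordinal m lm => False_rect _ (notF lm) end)
     (fun i => match i with Ordinal m lm => False_rect _ (notF lm) end))) => z Uz /=.
  by congr (ext0 _ _); apply/funext => v; congr (T v _ _); apply/funext => -[].
apply/funext => v; apply/funext => th; apply/funext => X.
have [ O [W [oO Ov sW aW Wv]]] := admissible_field v.
have dW : delta_local delta v W (delta v W).
  by exists W; split=> //; exact: nearW.
by rewrite TE (eD1.2 h sh v O W _ oO Ov aW Wv dW)
  (eD2.2 h sh v O W _ oO Ov aW Wv dW).
Qed.

Lemma derivation_unique_vec r s (T : tensor A r s.+1) :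
  (forall T' : tensor A r s, atensor T' -> D1 T' = D2 T') ->
  atensor T -> D1 T = D2 T.
Proof.
move=> ih aT; apply/funext => v; apply/funext => th; apply/funext => X.
have [W sW Wv] := vfield_through (foot v) (X ord0).
have aW : atensor (vfield_tensor W : tensor A 1 0) by exact: atensor_vfield.
have aWT : @atensor R n M A r.+1 s.+1 (prod_tensor (vfield_tensor W) T).
  exact: (atensor_prod A_open aW aT).
(* Expresses the value of D on T through its value on a tensor with one slot fewer and a term fixed
   by [delta], both of which agree for D1 and D2. *)
have E (D : forall r s, tensor A r s -> tensor A r s) (tD : tensor_derivation D)
    (eD : extends_derivation delta Z D) :
    D _ _ (@Defs.contraction R n M A r s ord0 ord0 (prod_tensor (vfield_tensor W) T))
      v th (fun i => X (lift ord0 i)) =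
    @Defs.contraction R n M A r s ord0 ord0
      (prod_tensor (vector_tensor (fun v => delta v W)) T) v th
      (fun i => X (lift ord0 i)) + D _ _ T v th X.
  rewrite (tder_contraction tD ord0 ord0 aWT).
  have -> := tder_prod tD aW aT; rewrite (eD.1 W sW).
  have -> : D _ _ T v th X =
      @Defs.contraction R n M A r s ord0 ord0
        (prod_tensor (vfield_tensor W) (D _ _ T)) v th (fun i => X (lift ord0 i)).
    have [mT _] := tder_closed tD aT.
    by rewrite (contraction_vfield _ _ _ _ mT) Wv insert_at_head.
  by rewrite /Defs.contraction /add_tensor -big_split.
have := E _ tD1 eD1; rewrite ih; last exact: atensor_contraction.
by rewrite (E _ tD2 eD2) => /addrI.
Qed.

(** The Leibniz rule leaves a term with the value of the derivation on dg; agreement on tensors of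
    type (0,1) takes care of it. *)
Lemma derivation_unique_cov r s (T : tensor A r.+1 s) :
  (forall T' : tensor A 0 1, atensor T' -> D1 T' = D2 T') ->
  (forall T' : tensor A r s, atensor T' -> D1 T' = D2 T') ->
  atensor T -> D1 T = D2 T.
Proof.
move=> ih1 ih aT; apply/funext => v; apply/funext => th; apply/funext => X.
have [g sg ga] := differential_through (foot v) (th ord0).
have ag := atensor_differential sg.
have agT : @atensor R n M A r.+1 s.+1 (prod_tensor (differential g) T).
  exact: (atensor_prod A_open ag aT).
have E (D : forall r s, tensor A r s -> tensor A r s) (tD : tensor_derivation D) :
    D _ _ (@Defs.contraction R n M A r s ord0 ord0 (prod_tensor (differential g) T))
      v (fun i => th (lift ord0 i)) X =
    @Defs.contraction R n M A r s ord0 ord0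
      (prod_tensor (D _ _ (differential g)) T) v
      (fun i => th (lift ord0 i)) X + D _ _ T v th X.
  rewrite (tder_contraction tD ord0 ord0 agT).
  have -> := tder_prod tD ag aT.
  have -> : D _ _ T v th X =
      @Defs.contraction R n M A r s ord0 ord0
        (prod_tensor (differential g) (D _ _ T)) v (fun i => th (lift ord0 i)) X.
    have [mT _] := tder_closed tD aT.
    by rewrite (contraction_differential _ _ mT ga) insert_at_head.
  by rewrite /Defs.contraction /add_tensor -big_split.
have := E _ tD1; rewrite ih; last exact: atensor_contraction.
by rewrite (E _ tD2) (ih1 _ ag) => /addrI.
Qed.

Lemma derivation_unique r s (T : tensor A r s) : atensor T -> D1 T = D2 T.
Proof.
(* All types (0, s) come first: the induction on contravariant slots uses type (0,1) at every stage
   and type (0, s) as its base. *)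
have vec s' : forall T' : tensor A 0 s', atensor T' -> D1 T' = D2 T'.
  elim: s' => [|m ih]; first exact: derivation_unique_scalar.
  by move=> T'; exact: derivation_unique_vec.
elim: r s T => [|r ih] s T; first exact: vec.
by apply: derivation_unique_cov; [exact: vec|exact: ih].
Qed.

End Uniqueness.

Theorem theorem2p11 (R : realType) (n : nat) (M : manifold R n)
    (A : set (tangent M)) (A_open : tangent_open A)
    (A_neq0 : forall u : tangent M, A u -> vec u <> 0)
    (A_surj : forall p : M, exists2 u : tangent M, A u & base u = p)
    (delta : A -> (M -> 'rV[R]_n) -> 'rV[R]_n) (Z : M -> 'rV[R]_n)
    (hdelta : anisotropic_derivation delta Z) :
  exists D : forall r s : nat, tensor A r s -> tensor A r s,
    [/\ tensor_derivation D, extends_derivation delta Z D &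
        forall D' : forall r s : nat, tensor A r s -> tensor A r s,
          tensor_derivation D' -> extends_derivation delta Z D' ->
          forall (r s : nat) (T : tensor A r s), atensor T ->
            D' r s T = D r s T].
Proof.
have tD := derivation_tensor_derivation A_open hdelta.
have eD := derivation_extends A_open hdelta.
exists (fun r s => @derivation R n M A delta Z r s); split=> // D' tD' eD' r s T aT.
exact: (derivation_unique A_open tD' tD eD' eD).
Qed.
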